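(* Let $S\subset\mathbb{P}^3$ be the Fermat quartic surface $X^4+Y^4+Z^4+W^4=0$. Then $\delta'[4]=4$ and $\delta'[2]=24$; hence $S$ has exactly 28 quasi-Galois points.
   Context: Everything is over $\mathbb{C}$. For a smooth quartic surface $S\subset\mathbb{P}^3$ and a point $P\in\mathbb{P}^3\setminus S$, let $\pi_P:S\to\mathbb{P}^2$ be the projection from $P$ (to a plane not containing $P$), and let $G[P]=\{\tau\in\mathrm{Bir}(S)\mid \pi_P\circ\tau=\pi_P\}$, where $\mathrm{Bir}(S)$ is the group of birational automorphisms of $S$. $P$ is quasi-Galois for $S$ if $|G[P]|\ge 2$, and Galois if $|G[P]|=\deg\pi_P=4$. Only points not lying on $S$ are considered. $\delta'[4]$ denotes the number of Galois points for $S$, and $\delta'[2]$ the number of quasi-Galois points for $S$ which are not Galois. *)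

(* Defs.v *)
From mathcomp Require Import all_boot all_order all_algebra.
From mathcomp Require Import boolp classical_sets functions cardinality.
From mathcomp Require Import mpoly.

Set Implicit Arguments.
Unset Strict Implicit.
Unset Printing Implicit Defensive.

Import GRing.Theory.
Local Open Scope classical_set_scope.
Local Open Scope ring_scope.

Section QuasiGaloisPoints.

Variable K : closedFieldType.

(* Points of P^3 are the one-dimensional subspaces of K^4, so that equality of
   points is Leibniz equality. *)
Definition P3 : set {vspace 'rV[K]_4} := [set P | \dim P = 1%N].

(* The nonzero vectors above the points of the surface F = 0, for F a form. *)
Definition surface (F : {mpoly K[4]}) : set 'rV[K]_4 :=
  [set v | v != 0 /\ F.@[v 0] = 0].

Definition lies_on (P : {vspace 'rV[K]_4}) (F : {mpoly K[4]}) : Prop :=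
  forall v, v \in P -> v != 0 -> surface F v.

Notation forms := (4.-tuple {mpoly K[4]}).

Definition eval_forms (f : forms) (v : 'rV[K]_4) : 'rV[K]_4 :=
  \row_j (tnth f j).@[v 0].

(* Rational maps from an irreducible surface S : F = 0 to P^3, in the classical
   language: a representative is a quadruple of forms of one degree that do not
   all vanish identically on S, and f, g represent the same rational map when
   f_i g_j = f_j g_i on S for all i, j. *)
Definition ratmap (F : {mpoly K[4]}) : set forms :=
  [set f | (exists d, forall i, tnth f i \is d.-homog) /\
           (exists2 v, surface F v & eval_forms f v != 0)].

Definition same_ratmap (F : {mpoly K[4]}) (f g : forms) : Prop :=
  [/\ ratmap F f, ratmap F g &
      forall v, surface F v -> forall i j,
        eval_forms f v 0 i * eval_forms g v 0 j =
        eval_forms f v 0 j * eval_forms g v 0 i].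

Definition ratmap_class (F : {mpoly K[4]}) (f : forms) : set forms :=
  [set g | same_ratmap F f g].

Definition self_ratmap (F : {mpoly K[4]}) (f : forms) : Prop :=
  ratmap F f /\
  forall v, surface F v -> eval_forms f v != 0 -> surface F (eval_forms f v).

Definition id_forms : forms := [tuple 'X_i | i < 4].

(* g after f.  The composite rational map is defined only when the resulting
   forms do not all vanish on S; same_ratmap includes that requirement. *)
Definition comp_forms (g f : forms) : forms := [tuple tnth g i \mPo f | i < 4].

Definition birational (F : {mpoly K[4]}) (f : forms) : Prop :=
  self_ratmap F f /\
  exists g, [/\ self_ratmap F g,
                same_ratmap F (comp_forms g f) id_forms &
                same_ratmap F (comp_forms f g) id_forms].

Definition Bir (F : {mpoly K[4]}) : set (set forms) :=
  [set ratmap_class F f | f in [set f | birational F f]].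

(* The projection from the point P: the linear projection along P onto a
   complement P^C, i.e. the map sending x to the intersection of the line Px
   with the plane P^C, which does not contain P.  Another choice of the plane
   changes the projection by an isomorphism between the two planes. *)
Definition proj_forms (P : {vspace 'rV[K]_4}) : forms :=
  [tuple \sum_(i < 4) (daddv_pi (P^C) P (delta_mx 0 i)) 0 j *: 'X_i | j < 4].

Definition G (F : {mpoly K[4]}) (P : {vspace 'rV[K]_4}) : set (set forms) :=
  [set t | Bir F t /\
    exists2 f, t f & same_ratmap F (comp_forms (proj_forms P) f) (proj_forms P)].

Local Open Scope card_scope.

Definition quasi_galois (F : {mpoly K[4]}) : set {vspace 'rV[K]_4} :=
  [set P | [/\ P3 P, ~ lies_on P F & `I_2 #<= G F P]].

(* For a quartic F the projection from a point outside S has degree 4. *)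
Definition galois (F : {mpoly K[4]}) : set {vspace 'rV[K]_4} :=
  [set P | [/\ P3 P, ~ lies_on P F & G F P #= `I_4]].

Definition fermat_quartic : {mpoly K[4]} := \sum_(i < 4) 'X_i ^+ 4.

End QuasiGaloisPoints.

(* Main.v *)
Require Import Defs.
From mathcomp Require Import all_boot all_order all_algebra.
From mathcomp Require Import boolp classical_sets functions cardinality reals.
From mathcomp Require Import complex mpoly.
From mathcomp Require Import ring zify.

(** Write F for the Fermat form X_0^4 + X_1^4 + X_2^4 + X_3^4 and let p span a
    point P off S.  A birational self-map of S that commutes with the projection
    from P moves each point along its line to P, so it has the shape
    v |-> v + h(v) p with h = N / D a quotient of forms of degrees d + 1 and d.
    The identity F(v + h p) = 0 is a polynomial equation for h whose leading
    coefficient is the nonzero constant F(p); hence h is locally bounded on the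
    affine cone over S.  This cone is normal, so h is a polynomial there, and by
    homogeneity a linear form l ([cone_normal_linear]).  The map is therefore the
    linear map v |-> v + l(v) p, and G[P] is in bijection with the linear forms
    l for which this map preserves F ([card_G]).

    These l are found by expanding: F(v + l(v) p) - F(v) is l times a cubic form,
    the [polar] below, which has to vanish when l is not 0.  On the plane l = 0
    this gives sum_i p_i v_i^3 = 0, and a diagonal cubic in three or more
    variables contains no plane, so p has at most two nonzero coordinates.
    - If p has one nonzero coordinate p_i, then 1 + l_i p_i is a fourth root of
      unity and l_j = 0 for j <> i: the group has order 4.  These are the four
      vertices of the coordinate tetrahedron.
    - If the nonzero coordinates are p_i and p_j, a computation forces
      l_i p_i = l_j p_j = -1 and p_i^4 = p_j^4: the group has order 2.  There are
      four such points on each of the six edges of the tetrahedron.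

    Two properties of the cone are needed, and both come from reducing
    polynomials to sum_(k < 4) b_k X_i^k, with b_k free of X_i, by means of
    X_i^4 = - sum_(j <> i) X_j^4.
    - Irreducibility ([cone_irreducible]).  On a line on which
      q = - sum_(j <> i) X_j^4 has a simple zero, the term b_k X_i^k has order
      4 ord(b_k) + k.  These orders differ for different k, so each of two
      nonzero reduced polynomials has a unique term of least order, and the
      product of these two terms cannot be cancelled.
    - Normality ([cone_normal]).  Multiplying N and D by the conjugates of D
      under the scaling of X_i by fourth roots of unity makes the denominator
      free of X_i, and averaging over the conjugates bounds each coefficient of
      the numerator.  A locally bounded quotient of polynomials is a polynomial
      ([mpoly_dvd_of_bounded]), as one sees on lines.  The outcome is that
      N X_i^4 is a multiple of D on the cone for every i; as X_0^4, X_1^4 is a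
      regular sequence on the cone, N itself is a multiple of D. *)

Set Implicit Arguments.
Unset Strict Implicit.
Unset Printing Implicit Defensive.

Import Order.TTheory GRing.Theory Num.Theory.

(** * Polynomials as functions *)

Section PolynomialFunctions.
Local Open Scope ring_scope.
Context (K : numFieldType) (n : nat).
Implicit Types (g c d : {mpoly K[n]}) (v u e : 'I_n -> K) (p q : {poly K}).

Lemma poly_nonroot p (f : nat -> K) :
  injective f -> p != 0 -> exists k, p.[f k] != 0.
Proof.
move=> f_inj p0; have := @max_poly_roots K p [seq f k | k <- iota 0 (size p)]
  p0.
rewrite size_map size_iota ltnn map_inj_uniq ?iota_uniq // => roots.
have [|/allPn[x /mapP[k _ ->] rk]] :=
  boolP (all (root p) [seq f k | k <- iota 0 (size p)]).
  by move=> /roots/(_ isT).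
by exists k.
Qed.

Lemma poly_eq0_eval p : (forall t, p.[t] = 0) -> p = 0.
Proof.
move=> p0; apply/eqP; apply: contraT => /(poly_nonroot (f := fun k => k%:R))[].
  by move=> a b /eqP; rewrite eqr_nat => /eqP.
by move=> k; rewrite p0 eqxx.
Qed.

Lemma poly_eq0_eval_generic p q :
  q != 0 -> (forall t, q.[t] != 0 -> p.[t] = 0) -> p = 0.
Proof.
move=> q0 pq; suff /eqP : p * q = 0 by rewrite mulf_eq0 (negPf q0) orbF => /eqP.
apply: poly_eq0_eval => t; rewrite hornerM.
by have [->|/pq->] := eqVneq q.[t] 0; rewrite ?mulr0 ?mul0r.
Qed.

Lemma mevalXn g k v : (g ^+ k).@[v] = g.@[v] ^+ k.
Proof. exact: rmorphXn. Qed.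

Definition set_coord v i x : 'I_n -> K := fun j => if j == i then x else v j.

Definition exact_part i (k : nat) g : {mpoly K[n]} :=
  \sum_(m <- msupp g | m i == k) g@_m *: 'X_[m].

Lemma mcoeff_exact_part i k g m : (exact_part i k g)@_m =
  if m i == k then g@_m else 0.
Proof.
rewrite /exact_part raddf_sum /=.
under eq_bigr do rewrite mcoeffZ mcoeffX.
have [mg|mg] := boolP (m \in msupp g); last first.
  rewrite (memN_msupp_eq0 mg) if_same big1_seq // => m' /andP[_ m'g].
  by case: eqP => [e|_]; rewrite ?mulr0 // -e m'g in mg *.
rewrite big_mkcond (bigD1_seq m) ?msupp_uniq //= eqxx mulr1 big1 ?addr0 //.
by move=> m' /negPf->; rewrite mulr0 if_same.
Qed.

(** Once the coordinates other than the [i]-th are frozen, [g] is a polynomial in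
    one variable, and its coefficients are, up to a power of [v i], the values of
    the parts of [g]. *)
Lemma meval_exact_part i k g v :
  (forall u, g.@[u] = 0) -> (exact_part i k g).@[v] = 0.
Proof.
move=> g0.
pose p := \sum_(m <- msupp g)
  (g@_m * \prod_(j | j != i) v j ^+ m j) *: 'X^(m i) : {poly K}.
have p0 : p = 0.
  apply: poly_eq0_eval => t; rewrite -(g0 (set_coord v i t)) mevalE horner_sum.
  apply: eq_bigr => m _; rewrite hornerZ hornerXn [in RHS](bigD1 i) //=
    /set_coord eqxx.
  rewrite -mulrA [_ * t ^+ _]mulrC; congr (_ * (_ * _)).
  by apply: eq_bigr => j /negPf->.
have -> : (exact_part i k g).@[v] = p`_k * v i ^+ k.
  rewrite /exact_part /p raddf_sum coef_sum mulr_suml [LHS]big_mkcond /=.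
  apply: eq_bigr => m _; rewrite coefZ coefXn [k == _]eq_sym mevalZ mevalX.
  case: eqP => [<-|_]; last by rewrite mulr0 mul0r.
  by rewrite (bigD1 i) //= mulr1 [_ * \prod_(_ | _) _]mulrC mulrA.
by rewrite p0 coef0 mul0r.
Qed.

(** Restricting the exponent of one variable after another isolates a single
    monomial, and each restriction preserves the vanishing of all values. *)
Lemma mpoly_eq0_eval g : (forall v, g.@[v] = 0) -> g = 0.
Proof.
move=> g0; apply/mpolyP => m0; rewrite mcoeff0.
pose parts (s : seq 'I_n) := foldr (fun i h => exact_part i (m0 i) h) g s.
have E s m : (parts s)@_m = if all (fun i => m i == m0 i) s then g@_m else 0.
  by elim: s m => //= i s IH m; rewrite mcoeff_exact_part IH; case: eqP.
have V s v : (parts s).@[v] = 0.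
  elim: s v => [|i s IH] v; first exact: g0.
  exact: meval_exact_part.
have : parts (enum 'I_n) = g@_m0 *: 'X_[m0].
  apply/mpolyP => m; rewrite E mcoeffZ mcoeffX eq_sym.
  have [->|ne] := eqVneq m m0.
    by rewrite mulr1 ifT //; apply/allP.
  rewrite mulr0 ifF //; apply: contraNF ne => /allP a.
  by apply/eqP/mnmP => i; apply/eqP/a; rewrite mem_enum.
move/(congr1 (meval (fun=> 1))); rewrite V mevalZ mevalX big1 ?mulr1 //.
by move=> i _; rewrite expr1n.
Qed.

Lemma mpoly_eval_neq0 g : g != 0 -> exists v, g.@[v] != 0.
Proof.
move=> g0; have [//|none] := boolp.pselect (exists v, g.@[v] != 0).
case/eqP: g0; apply: mpoly_eq0_eval => v.
by apply/eqP; apply: contraT => vn; case: none; exists v.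
Qed.

Lemma mpoly_eq0_eval_generic g d :
  d != 0 -> (forall v, d.@[v] != 0 -> g.@[v] = 0) -> g = 0.
Proof.
move=> d0 gd; suff /eqP : g * d = 0 by rewrite mulf_eq0 (negPf d0) orbF => /eqP.
apply: mpoly_eq0_eval => v; rewrite mevalM.
by have [->|/gd->] := eqVneq d.@[v] 0; rewrite ?mulr0 ?mul0r.
Qed.

Definition line u e g : {poly K} :=
  mmap (@polyC K) (fun i => (u i)%:P + e i *: 'X) g.

Lemma horner_line u e g t : (line u e g).[t] = g.@[fun i => u i + t * e i].
Proof.
rewrite /line /mmap horner_sum mevalE; apply: eq_bigr => m _.
rewrite hornerCM; congr (_ * _); rewrite /mmap1 horner_prod.
by apply: eq_bigr => i _; rewrite horner_exp !hornerE mulrC.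
Qed.

Lemma lineM u e c d : line u e (c * d) = line u e c * line u e d.
Proof. exact: rmorphM. Qed.

(** A division carried out on the line through the generic point specializes to all
    lines parallel to [e]. *)
Definition generic_line e g : {poly {mpoly K[n]}} :=
  mmap (polyC \o @mpolyC n K) (fun i => ('X_i)%:P + (e i)%:MP *: 'X) g.

Lemma map_generic_line u e g : map_poly (meval u) (generic_line e g) =
  line u e g.
Proof.
rewrite /generic_line /line /mmap rmorph_sum; apply: eq_bigr => m _.
rewrite rmorphM /= map_polyC /= mevalC; congr (_ * _).
rewrite /mmap1 rmorph_prod; apply: eq_bigr => i _.
by rewrite rmorphXn rmorphD /= map_polyC map_polyZ map_polyX /= mevalXU mevalC.
Qed.

Lemma generic_line0 e g : (generic_line e g).[0] = g.
Proof.
rewrite /generic_line /mmap horner_sum [RHS]mpolyE; apply: eq_bigr => m _.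
rewrite hornerCM mul_mpolyC /mmap1 horner_prod; congr (_ *: _).
rewrite [RHS]mpolyXE_id; apply: eq_bigr => i _.
by rewrite horner_exp hornerD hornerC hornerZ hornerX mulr0 addr0.
Qed.

(** Along a line with direction [b] the leading coefficient of a monomial is its
    value at [b], whatever the base point [a]: this is what makes a form have a
    constant leading coefficient on the generic line. *)
Lemma coef_prod_linear (A : comNzRingType) (a b : 'I_n -> A) (m : 'X_{1..n}) :
  let P := \prod_i ((a i)%:P + b i *: 'X) ^+ m i in
  (size P <= (mdeg m).+1)%N /\ P`_(mdeg m) = \prod_i b i ^+ m i.
Proof.
have lin (x y : A) : (size (x%:P + y *: 'X)%R <= 2)%N /\ (x%:P + y *: 'X)`_1 =
  y.
  split; last by rewrite coefD coefC coefZ coefX /= add0r mulr1.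
  rewrite (leq_trans (size_polyD _ _)) // geq_max.
  rewrite (leq_trans (size_polyC_leq1 _)) //.
  by rewrite (leq_trans (size_scale_leq _ _)) // size_polyX.
have mul (p1 p2 : {poly A}) (d1 d2 : nat) :
    (size p1 <= d1.+1)%N -> (size p2 <= d2.+1)%N ->
    (size (p1 * p2)%R <= (d1 + d2).+1)%N /\ (p1 * p2)`_(d1 + d2) =
      p1`_d1 * p2`_d2.
  move=> s1 s2; split.
    by have := size_polyMleq p1 p2; lia.
  rewrite coefM (bigD1 (inord d1 : 'I_(d1 + d2).+1)) //=.
  rewrite inordK ?ltnS ?leq_addr // addKn big1 ?addr0 // => j.
  rewrite -val_eqE /= inordK ?ltnS ?leq_addr // => jd.
  have [j1|j1] := ltnP d1 j.
    by rewrite nth_default ?mul0r // (leq_trans s1).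
  have lt : (j < d1)%N by rewrite ltn_neqAle jd.
  rewrite [p2`__]nth_default ?mulr0 // (leq_trans s2) //.
  by lia.
have pow (x y : A) k : (size ((x%:P + y *: 'X) ^+ k)%R <= k.+1)%N /\
    ((x%:P + y *: 'X) ^+ k)`_k = y ^+ k.
  elim: k => [|k [s1 c1]]; first by rewrite !expr0 size_poly1 coef1.
  have [l1 l2] := lin x y; rewrite !exprS.
  by have [-> e] := mul _ _ 1%N k l1 s1; rewrite -add1n e l2 c1.
rewrite /= mdegE; elim/big_rec3: _ => [|i d y P _ [s <-]].
  by rewrite -polyC1 coefC; split; first exact: size_polyC_leq1.
have [s1 <-] := pow (a i) (b i) (m i).
exact: mul.
Qed.

End PolynomialFunctions.

(** * Divisibility of polynomials, tested on lines *)

Section Divisibility.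
Local Open Scope ring_scope.
Context (K : numFieldType) (n : nat).
Implicit Types (g c d : {mpoly K[n]}) (v u e : 'I_n -> K).

Lemma generic_line_homog e d (D : nat) : d \is D.-homog ->
  (size (generic_line e d) <= D.+1)%N /\ (generic_line e d)`_D = (d.@[e])%:MP.
Proof.
move/dhomogP => hd; rewrite /generic_line /mmap mevalE rmorph_sum /= coef_sum.
have lin m : m \in msupp d ->
    let P := \prod_(i < n) (('X_i)%:P + (e i)%:MP *: 'X) ^+ m i
      : {poly {mpoly K[n]}} in
    (size P <= D.+1)%N /\ P`_D = (\prod_(i < n) e i ^+ m i)%:MP.
  move=> md; rewrite -(hd m md).
  have [s c] := coef_prod_linear (fun i => 'X_i : {mpoly K[n]}) (fun i =>
    (e i)%:MP) m.
  split=> //; rewrite c rmorph_prod; apply: eq_bigr => i _.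
  by rewrite rmorphXn.
split.
  rewrite (leq_trans (size_sum _ _ _)) // big_seq;
    apply/bigmax_leqP_seq => m _ md.
  rewrite mul_polyC (leq_trans (size_scale_leq _ _)) //.
  by have [] := lin m md.
rewrite big_seq [RHS]big_seq; apply: eq_bigr => m md.
by rewrite mul_polyC coefZ /mmap1 (lin m md).2 /= mpolyCM.
Qed.

(** On the generic line in the direction [e] the leading coefficient of [d] is the
    constant [d.@[e]], so [c] can be divided by [d] with remainder.  The remainder
    specializes to the remainders on the actual lines, which vanish, and a
    polynomial is zero as soon as it vanishes where [r] does not. *)
Lemma dvd_of_lines e (D : nat) c d r : d \is D.-homog -> d.@[e] != 0 ->
  r != 0 ->
  (forall u, r.@[u] != 0 -> line u e d %| line u e c) ->
  exists g, c = g * d.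
Proof.
move=> hd de r0 dvd.
have [sz lc] := generic_line_homog e hd.
pose a := d.@[e]; pose M := (a^-1)%:MP *: generic_line e d.
have szM : size M = D.+1.
  apply/eqP; rewrite eqn_leq (leq_trans (size_scale_leq _ _)) //=.
  rewrite ltnNge; apply/negP => /leq_sizeP/(_ D (leqnn _)).
  rewrite coefZ lc -mpolyCM mulVf // => /eqP.
  by rewrite mpolyC_eq0 oner_eq0.
have mM : M \is monic.
  by rewrite monicE lead_coefE szM /= coefZ lc -mpolyCM mulVf.
pose Q := Pdiv.Ring.rdivp (generic_line e c) M;
  pose Rm := Pdiv.Ring.rmodp (generic_line e c) M.
have eqM : generic_line e c = Q * M + Rm by exact: Pdiv.RingMonic.rdivp_eq.
have szR : (size Rm < size M)%N by rewrite Pdiv.Ring.ltn_rmodp monic_neq0.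
have mapM u : map_poly (meval u) M = a^-1 *: line u e d.
  by rewrite map_polyZ /= mevalC map_generic_line.
have R0 : Rm = 0.
  apply/polyP => k; rewrite coef0; apply: (mpoly_eq0_eval_generic r0) => u ru.
  suff /polyP/(_ k) : map_poly (meval u) Rm = 0 by rewrite coef_map coef0.
  have := dvd u ru.
  rewrite -[in X in _ %| X]map_generic_line eqM rmorphD rmorphM /= mapM.
  rewrite -(@dvdpZl _ a^-1) ?invr_eq0 // -mapM dvdp_addr ?dvdp_mull // => dR.
  apply/eqP; apply: contraT => Rn.
  have := dvdp_leq Rn dR; rewrite leqNgt (leq_ltn_trans (size_poly _ _)) //.
  by rewrite size_map_poly_id0 // (eqP mM) rmorph1 oner_neq0.
exists ((a^-1)%:MP * Q.[0]).
rewrite -[LHS](generic_line0 e c) eqM R0 addr0 hornerM hornerZ (generic_line0 e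
  d).
by rewrite mulrCA mulrA.
Qed.

End Divisibility.

(** * Locally bounded quotients of polynomials *)

Section LocallyBoundedQuotients.
Local Open Scope ring_scope.
Context (K : numClosedFieldType).
Implicit Types (p q : {poly K}).

Lemma poly_lipschitz p t0 : exists2 B, 0 <= B &
  forall t, `|t - t0| <= 1 -> `|p.[t] - p.[t0]| <= B * `|t - t0|.
Proof.
have /factor_theorem[r er] : root (p - p.[t0]%:P) t0.
  by rewrite rootE !hornerE subrr.
pose rho := 1 + `|t0|; exists (\sum_(i < size r) `|r`_i| * rho ^+ i).
  by apply: sumr_ge0 => i _; rewrite mulr_ge0 ?exprn_ge0 ?addr_ge0.
move=> t tt0; have -> : p.[t] - p.[t0] = r.[t] * (t - t0).
  by have := congr1 (horner^~ t) er; rewrite !hornerE.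
rewrite normrM ler_wpM2r // horner_coef.
apply: le_trans (ler_norm_sum _ _ _) _; apply: ler_sum => i _.
rewrite normrM normrX ler_wpM2l // lerXn2r ?nnegrE ?addr_ge0 //.
by rewrite -[t](subrK t0) (le_trans (ler_normD _ _)) // lerD2r.
Qed.

(** After division by the gcd, the numerator would have to tend to 0 at any root of
    the denominator, hence to share this root. *)
Lemma dvdp_of_bounded p q : q != 0 ->
  (forall rho, exists2 M, 0 <= M &
     forall t, `|t| <= rho -> `|p.[t]| <= M * `|q.[t]|) ->
  q %| p.
Proof.
move=> q0 bnd; have g0 : gcdp p q != 0 by rewrite gcdp_eq0 negb_and q0 orbT.
pose g := gcdp p q; pose p1 := p %/ g; pose q1 := q %/ g.
have ep : p = p1 * g by rewrite divpK ?dvdp_gcdl.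
have eq : q = q1 * g by rewrite divpK ?dvdp_gcdr.
have cop : coprimep p1 q1 by rewrite coprimep_div_gcd // q0 orbT.
have [s1|s1] := eqVneq (size q1) 1%N.
  by rewrite ep eq dvdp_mul // (eqp_dvdl _ (_ : _ %= 1)) ?dvd1p //
    -size_poly_eq1 s1.
have [t0 rt0] := closed_rootP q1 s1.
have pt0 : p1.[t0] != 0 by apply: (coprimep_root (p := q1));
  rewrite // coprimep_sym.
have [M M0 leM] := bnd (1 + `|t0|).
have [Bp Bp0 lip_p] := poly_lipschitz p1 t0.
have [Bq Bq0 lip_q] := poly_lipschitz q1 t0.
pose B := Bp + M * Bq; have B0 : 0 <= B by rewrite addr_ge0 ?mulr_ge0.
have le_at t : `|t - t0| <= 1 -> g.[t] != 0 -> `|p1.[t0]| <= B * `|t - t0|.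
  move=> t1 gt; have /leM : `|t| <= 1 + `|t0|.
    by rewrite -[t](subrK t0) (le_trans (ler_normD _ _)) // lerD2r.
  rewrite ep eq !hornerM !normrM mulrA ler_pM2r ?normr_gt0 // => le1.
  have := lip_q t t1; rewrite (rootP rt0) subr0 => le2.
  rewrite -[p1.[t0]](subrK p1.[t]) mulrDl (le_trans (ler_normD _ _)) //.
  rewrite lerD //; first by rewrite distrC lip_p.
  by rewrite (le_trans le1) // -mulrA ler_wpM2l.
pose eta := `|p1.[t0]|; have eta0 : 0 < eta by rewrite normr_gt0.
(* With this choice [eps <= 1] and [B * eps < eta], and one of the points
   [t0 + eps / k.+1%:R] avoids the finitely many roots of [g]. *)
pose eps := eta / (eta + B + 1).
have den0 : 0 < eta + B + 1 by rewrite ltr_wpDl ?ltr01 // addr_ge0 // ltW.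
have eps0 : 0 < eps by rewrite divr_gt0.
have [|k gk] := poly_nonroot (f := fun k : nat => t0 + eps / k.+1%:R) _ g0.
  move=> a b /addrI/(mulfI (lt0r_neq0 eps0))/invr_inj/eqP.
  by rewrite eqr_nat => /eqP[].
have Etk : `|t0 + eps / k.+1%:R - t0| = eps / k.+1%:R.
  by rewrite addrC addKr ger0_norm // divr_ge0 ?ltW ?ler0n.
have le_eps : eps / k.+1%:R <= eps.
  by rewrite ler_pdivrMr ?ltr0n // ler_peMr ?ler1n // ltW.
have le1 : eps / k.+1%:R <= 1.
  by rewrite (le_trans le_eps) // ler_pdivrMr // mul1r -addrA lerDl addr_ge0.
have lt_eta : B * (eps / k.+1%:R) < eta.
  rewrite (le_lt_trans (ler_wpM2l B0 le_eps)) // mulrA ltr_pdivrMr //.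
  by rewrite mulrC ltr_pM2l // addrAC ltrDr ltr_wpDl ?ltr01 // ltW.
by have := le_at _ _ gk; rewrite Etk (lt_geF lt_eta) => /(_ le1).
Qed.

(** This is the normality of affine space: a bound on the quotient restricts to
    every line, where it gives divisibility. *)
Lemma mpoly_dvd_of_bounded n (c d : {mpoly K[n]}) (D : nat) :
  d \is D.-homog -> d != 0 ->
  (forall rho, exists2 M, 0 <= M & forall u : 'I_n -> K,
     (forall i, `|u i| <= rho) -> `|c.@[u]| <= M * `|d.@[u]|) ->
  exists g, c = g * d.
Proof.
move=> hd d0 bnd; have [e de] := mpoly_eval_neq0 d0.
apply: (dvd_of_lines hd de (oner_neq0 _)) => u _.
apply: dvdp_of_bounded.
  apply/eqP => /(congr1 (fun p => p`_D));
    rewrite coef0 -map_generic_line coef_map.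
  by rewrite (generic_line_homog e hd).2 /= mevalC; apply/eqP.
move=> rho; pose rho' := \sum_i (`|u i| + `|rho| * `|e i|).
have [M M0 leM] := bnd rho'; exists M => // t tr; rewrite !horner_line.
apply: leM => i; rewrite /rho' (bigD1 i) //=.
rewrite -[leLHS]addr0 lerD //; last first.
  by apply: sumr_ge0 => j _; rewrite addr_ge0 ?mulr_ge0.
rewrite (le_trans (ler_normD _ _)) // lerD2l normrM ler_wpM2r //.
by rewrite (le_trans tr) // real_ler_norm // ger0_real // (le_trans _ tr).
Qed.

End LocallyBoundedQuotients.

(** * The affine cone over the Fermat quartic *)

Section Cone.
Local Open Scope ring_scope.
Context (K : numClosedFieldType).
Implicit Types (g c d : {mpoly K[4]}) (v u e : 'I_4 -> K).

Definition cone v := \sum_i v i ^+ 4 = 0.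
Definition vanish g := forall v, cone v -> g.@[v] = 0.
Definition free_of i g := forall v x, g.@[set_coord v i x] = g.@[v].

Definition other_powers i : {mpoly K[4]} := \sum_(j | j != i) 'X_j ^+ 4.

Lemma meval_other_powers i v : (other_powers i).@[v] =
  \sum_(j | j != i) v j ^+ 4.
Proof.
by rewrite raddf_sum; apply: eq_bigr => j _ /=; rewrite rmorphXn /= mevalXU.
Qed.

Lemma coneP i v : cone v <-> v i ^+ 4 = - (other_powers i).@[v].
Proof.
rewrite /cone meval_other_powers (bigD1 i) //=; split=> [/eqP|->].
  by rewrite addr_eq0 => /eqP.
by rewrite addNr.
Qed.

Lemma set_coordE v i x : set_coord v i x i = x.
Proof. by rewrite /set_coord eqxx. Qed.

Lemma free_of_other_powers i : free_of i (other_powers i).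
Proof.
move=> v x; rewrite !meval_other_powers; apply: eq_bigr => j /negPf ji.
by rewrite /set_coord ji.
Qed.

Lemma cone_lift u i : exists2 x, cone (set_coord u i x) & x ^+ 4 =
  - (other_powers i).@[u].
Proof.
exists (4.-root (- (other_powers i).@[u])); last by rewrite rootCK.
by apply/(coneP i); rewrite set_coordE free_of_other_powers rootCK.
Qed.

Lemma other_powers_neq0 i : other_powers i != 0.
Proof.
apply/eqP => /(congr1 (meval (fun=> 1))); rewrite meval0 meval_other_powers.
under eq_bigr do rewrite expr1n.
by rewrite sumr_const cardC1 card_ord => /eqP; rewrite pnatr_eq0.
Qed.

Lemma other_powers_homog i : other_powers i \is 4.-homog.
Proof.
apply: rpred_sum => j _; apply: (@dhomogMn _ _ mdeg 1 'X_j 4).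
by rewrite dhomogX /= mdeg1.
Qed.

(** Fourier inversion for the action of the fourth roots of unity on the variable:
    averaging over the four conjugates of [x] isolates one power. *)
Lemma sum_powers_of_i (a : 'I_4 -> K) (k : 'I_4) x :
  \sum_(j < 4) 'i ^+ (j * (4 - k)) * (\sum_(l < 4) a l * ('i ^+ j * x) ^+ l) =
  4%:R * (a k * x ^+ k).
Proof.
have i2 : 'i * 'i = -1 :> K by rewrite -expr2 sqrCi.
case: k => [[|[|[|[|k]]]] lk] //; rewrite !big_ord_recl !big_ord0 /=;
  rewrite /bump /=; set a0 := a _; set a1 := a _; set a2 := a _; set a3 := a _.
- by rewrite (_ : Ordinal lk = ord0) -/a0; [ring: i2|apply: val_inj].
- by rewrite (_ : Ordinal lk = lift ord0 ord0) -/a1; [ring: i2|apply: val_inj].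
- by rewrite (_ : Ordinal lk = lift ord0 (lift ord0 ord0)) -/a2;
  [ring: i2|apply: val_inj].
- by rewrite (_ : Ordinal lk = lift ord0 (lift ord0 (lift ord0 ord0))) -/a3;
  [ring: i2|apply: val_inj].
Qed.

Definition erase_mnm i (m : 'X_{1..4}) : 'X_{1..4} :=
  [multinom if j == i then 0%N else m j | j < 4].

(** The coefficient of [X_i^k] in the monomial [m] once [X_i^4] has been replaced
    by the value it takes on the cone. *)
Definition red_mnm i (k : nat) (m : 'X_{1..4}) : {mpoly K[4]} :=
  if (m i %% 4)%N == k then (- other_powers i) ^+ (m i %/ 4) * 'X_[erase_mnm i
    m]
  else 0.

Definition red_coef i (k : nat) g : {mpoly K[4]} :=
  \sum_(m <- msupp g) g@_m *: red_mnm i k m.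

Lemma mdeg_erase_mnm i m : mdeg m = (mdeg (erase_mnm i m) + m i)%N.
Proof.
rewrite !mdegE (bigD1 i) //= [in RHS](bigD1 i) //= mnmE eqxx add0n addnC.
by congr (_ + _)%N; apply: eq_bigr => j /negPf ji; rewrite mnmE ji.
Qed.

Lemma red_coef_homog i k g D : g \is D.-homog ->
  red_coef i k g \is (D - k).-homog.
Proof.
move/dhomogP => hg; rewrite /red_coef big_seq; apply: rpred_sum => m mg.
apply: dhomogZ; rewrite /red_mnm; case: eqP => [<-|_]; last exact: dhomog0.
have -> : (D - m i %% 4 = 4 * (m i %/ 4) + mdeg (erase_mnm i m))%N.
  have := mdeg_erase_mnm i m; rewrite (hg _ mg) /= => ->.
  by have := divn_eq (m i) 4; lia.
apply: dhomogM; last by rewrite dhomogX.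
by apply: dhomogMn; rewrite rpredN other_powers_homog.
Qed.

Lemma red_coef_free i k g : free_of i (red_coef i k g).
Proof.
move=> v x; rewrite /red_coef !raddf_sum; apply: eq_bigr => m _ /=.
rewrite !mevalZ /red_mnm; case: eqP => _; last by rewrite !meval0.
rewrite !mevalM !rmorphXn /= !mevalN free_of_other_powers !mevalX.
congr (_ * (_ * _)); apply: eq_bigr => j _; rewrite mnmE /set_coord.
by case: eqP.
Qed.

(** A monomial of degree less than 4 in [X_i] is already reduced, so that for it
    the identity also holds off the cone. *)
Lemma red_mnmE (i : 'I_4) (m : 'X_{1..4}) v : (m i < 4)%N \/ cone v ->
  ('X_[m] : {mpoly K[4]}).@[v] = \sum_(k < 4) (red_mnm i k m).@[v] * v i ^+ k.
Proof.
move=> small_or_cone; have lt4 : (m i %% 4 < 4)%N by rewrite ltn_mod.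
rewrite [in RHS](bigD1 (Ordinal lt4)) //= /red_mnm eqxx [X in _ =
  _ + X]big1 ?addr0.
  have e : (- other_powers i).@[v] ^+ (m i %/ 4) = (v i ^+ 4) ^+ (m i %/ 4).
    by case: small_or_cone => [/divn_small-> //|/(coneP i)->]; rewrite mevalN.
  rewrite mevalM mevalXn e !mevalX -exprM.
  rewrite mulrAC -exprD mulnC -divn_eq (bigD1 i) //=; congr (_ * _).
  rewrite [RHS](bigD1 i) //= mnmE eqxx expr0 mul1r.
  by apply: eq_bigr => j /negPf ji; rewrite mnmE ji.
move=> k; rewrite -val_eqE eq_sym /= => /negPf->.
by rewrite meval0 mul0r.
Qed.

Lemma red_coefE_in i g v : {in msupp g, forall m : 'X_{1..4}, (m i < 4)%N \/
  cone v} ->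
  g.@[v] = \sum_(k < 4) (red_coef i k g).@[v] * v i ^+ k.
Proof.
move=> h; rewrite /red_coef.
under eq_bigr do rewrite raddf_sum mulr_suml /=.
rewrite exchange_big mevalE big_seq [RHS]big_seq; apply: eq_bigr => m mg /=.
under [in RHS]eq_bigr do rewrite mevalZ -mulrA.
by rewrite -mulr_sumr -red_mnmE ?mevalX //; apply: h.
Qed.

Lemma red_coefE i g v : cone v -> g.@[v] =
  \sum_(k < 4) (red_coef i k g).@[v] * v i ^+ k.
Proof. by move=> cv; apply: red_coefE_in => m _; right. Qed.

(** Over a point where the other fourth powers do not add up to 0 the cone has four
    conjugate points, enough to recover the four coefficients by Fourier
    inversion. *)
Lemma red_coef_unique i (b : 'I_4 -> {mpoly K[4]}) :
  (forall k, free_of i (b k)) ->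
  (forall v, cone v -> \sum_k (b k).@[v] * v i ^+ k = 0) ->
  forall k, b k = 0.
Proof.
move=> ib b0 k; apply: (mpoly_eq0_eval_generic (other_powers_neq0 i)) => u qu.
have [x cx x4] := cone_lift u i.
have x0 : x != 0 by apply: contraNneq qu => x0; move/eqP: x4;
  rewrite x0 expr0n eq_sym oppr_eq0.
have := sum_powers_of_i (fun l => (b l).@[u]) k x.
rewrite big1 => [/esym/eqP|j _].
  by rewrite !mulf_eq0 pnatr_eq0 expf_eq0 (negPf x0) andbF orbF => /eqP.
set s := \sum_(l < 4) _; suff -> : s = 0 by rewrite mulr0.
rewrite -(b0 (set_coord u i ('i ^+ j * x))); last first.
  apply/(coneP i); rewrite set_coordE free_of_other_powers exprMn -exprM mulnC
    exprM.
  by rewrite (exprM _ 2 2) sqrCi sqrrN !expr1n mul1r.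
by apply: eq_bigr => l _; rewrite ib set_coordE.
Qed.

(** A form of degree less than 4 is its own reduction. *)
Lemma vanish_small_degree g (d : nat) :
  (d < 4)%N -> g \is d.-homog -> vanish g -> g = 0.
Proof.
move=> d4 /dhomogP hg vg; pose i : 'I_4 := ord0.
have nf0 : forall k : 'I_4, red_coef i k g = 0.
  apply: (@red_coef_unique i) => [k|v cv]; first exact: red_coef_free.
  by rewrite -red_coefE // vg.
apply: mpoly_eq0_eval => v; rewrite (@red_coefE_in i) => [|m mg].
  by rewrite big1 // => k _; rewrite nf0 meval0 mul0r.
left; rewrite (leq_ltn_trans _ d4) // -(hg m mg) /= mdegE (bigD1 i) //=.
exact: leq_addr.
Qed.

(** Different indices have different weights [4 * mk + k], so one of the two
    inequalities between weights is strict; as the index sums agree modulo 4, a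
    larger total weight means a larger order. *)
Lemma weight_lt (k l k1 l1 mk ml mk1 ml1 : nat) :
  (k < 4)%N -> (l < 4)%N -> (k1 < 4)%N -> (l1 < 4)%N ->
  k + l = k1 + l1 %[mod 4] ->
  (4 * mk1 + k1 <= 4 * mk + k)%N -> (4 * ml1 + l1 <= 4 * ml + l)%N ->
  ~~ ((k == k1) && (l == l1)) ->
  ((k1 + l1) %/ 4 + (mk1 + ml1) < (k + l) %/ 4 + (mk + ml))%N.
Proof.
move=> k4 l4 k14 l14 r wk wl ne.
have := divn_eq (k + l) 4; have := divn_eq (k1 + l1) 4; rewrite r.
move: (_ %/ 4)%N (_ %/ 4)%N (_ %% 4)%N => x y z e1 e2; clear r.
have [kk|kk] := eqVneq k k1; first by move: ne; rewrite kk eqxx /= => /eqP; lia.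
by move/eqP: kk; clear ne; lia.
Qed.

(** The ring K[t][w] / (w^4 - q) is a domain when [q] has a simple zero at 0: give
    [w] order 1 and [t] order 4.  The terms of an element then have distinct
    orders, and the product of the terms of least order of two factors is, among
    the contributions to its power of [w], the only one of least order. *)
Lemma kummer_domain (q : {poly K}) (a b : 'I_4 -> {poly K}) k0 l0 :
  mup 0 q = 1%N -> q != 0 -> a k0 != 0 -> b l0 != 0 ->
  ~ forall r : 'I_4, \sum_(k < 4) \sum_(l < 4)
      (if ((k + l) %% 4)%N == r then q ^+ ((k + l) %/ 4) * (a k * b l) else 0) =
        0.
Proof.
move=> q1 q0 a0 b0.
pose va k := (4 * mup 0 (a k) + k)%N; pose vb l := (4 * mup 0 (b l) + l)%N.
case: (@arg_minnP _ k0 (fun k => a k != 0) va a0) => k1 ak1 min_k;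
  case: (@arg_minnP _ l0 (fun l => b l != 0) vb b0) => l1 bl1 min_l.
have mupq j : mup 0 (q ^+ j) = j.
  elim: j => [|j IH]; first by rewrite expr0 mupNroot // root1.
  by rewrite exprS mupM ?expf_neq0 // IH q1.
have mup_term k l : a k != 0 -> b l != 0 ->
    mup 0 (q ^+ ((k + l) %/ 4) * (a k * b l)) =
    ((k + l) %/ 4 + (mup 0%R (a k) + mup 0%R (b l)))%N.
  by move=> ak bl; rewrite !mupM ?mulf_neq0 ?expf_neq0 // mupq.
have lt4 : ((k1 + l1) %% 4 < 4)%N by rewrite ltn_mod.
move/(_ (Ordinal lt4)); rewrite pair_big (bigD1 (k1, l1)) //= eqxx.
move/eqP; rewrite addr_eq0 => /eqP E.
have := mup_term _ _ ak1 bl1; set t := _ * _ => mt.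
have t0 : t != 0 by rewrite !mulf_neq0 ?expf_neq0.
suff : ((mup 0%R t).+1 <= mup 0%R t)%N by rewrite ltnn.
rewrite mup_geq // {2}/t E dvdpNr.
apply: (big_ind (dvdp _)) => [|x y|[k l] /= kl];
  [exact: dvdp0|exact: dvdp_add|].
case: eqP => // r; have [->|ak] := eqVneq (a k) 0; first by rewrite mul0r mulr0.
have [->|bl] := eqVneq (b l) 0; first by rewrite !mulr0.
rewrite -mup_geq ?mulf_neq0 ?expf_neq0 // mt mup_term //.
apply: weight_lt (min_k _ ak) (min_l _ bl) _ => //.
Qed.

End Cone.

(** * Irreducibility of the cone *)

Section Irreducible.
Local Open Scope ring_scope.
Context (K : numClosedFieldType).
Implicit Types (g c d : {mpoly K[4]}) (v u e : 'I_4 -> K).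

Lemma mup_simple_root (p : {poly K}) x :
  root p x -> ~~ root p^`() x -> mup x p = 1%N.
Proof.
case/factor_theorem => r ->; rewrite derivM derivXsubC mulr1 rootE.
rewrite !hornerE subrr mulr0 add0r -rootE => rx.
by rewrite mupMr // (@mup_XsubCX _ 1) eqxx.
Qed.

Lemma deriv_linear_exp4 (A : comNzRingType) (x y : A) :
  ((x%:P + y *: 'X) ^+ 4)^`().[0] = 4%:R * (x ^+ 3 * y).
Proof.
rewrite deriv_exp derivD derivC derivZ derivX hornerMn hornerM horner_exp.
by rewrite !hornerE -mulr_natl /=; ring.
Qed.

Lemma line_other_powers u e i :
  line u e (other_powers K i) = \sum_(j | j != i) ((u j)%:P + e j *: 'X) ^+ 4.
Proof.
rewrite /line rmorph_sum; apply: eq_bigr => j _ /=.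
by rewrite rmorphXn /= mmapX mmap1U.
Qed.

(** The coefficients of the reduction of a product, in terms of those of the
    factors. *)
Definition mul_red i a b (r : 'I_4) : {mpoly K[4]} :=
  \sum_(k < 4) \sum_(l < 4)
    if ((k + l) %% 4)%N == r
    then (- other_powers K i) ^+ ((k + l) %/ 4) * (red_coef i k a * red_coef i l
      b) else 0.

Lemma mul_red_free i a b r : free_of i (mul_red i a b r).
Proof.
move=> v x; rewrite /mul_red ![(\sum_(k < 4) _).@[_]]raddf_sum.
apply: eq_bigr => k _ /=; rewrite ![(\sum_(l < 4) _).@[_]]raddf_sum.
apply: eq_bigr => l _ /=; case: eqP => _; last by rewrite !meval0.
by rewrite !mevalM !red_coef_free !mevalXn !mevalN free_of_other_powers.
Qed.

Lemma mul_redE i a b v : cone v ->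
  \sum_(r < 4) (mul_red i a b r).@[v] * v i ^+ r = (a * b).@[v].
Proof.
move=> cv; rewrite mevalM !(red_coefE i _ cv) mulr_suml.
under eq_bigr => r _.
  rewrite /mul_red raddf_sum mulr_suml;
    under eq_bigr do rewrite /= raddf_sum mulr_suml.
  over.
rewrite exchange_big; apply: eq_bigr => k _ /=.
rewrite exchange_big mulr_sumr; apply: eq_bigr => l _ /=.
have lt4 : ((k + l) %% 4 < 4)%N by rewrite ltn_mod.
rewrite (bigD1 (Ordinal lt4)) //= eqxx [X in _ + X]big1 ?addr0.
  rewrite !mevalM mevalXn mevalN -((coneP i v).1 cv) -exprM mulrAC -exprD.
  by rewrite mulnC -divn_eq exprD; ring.
by move=> r; rewrite -val_eqE eq_sym /= => /negPf->; rewrite meval0 mul0r.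
Qed.

(** Let [a] and [b] have the nonzero coefficients [red_coef i k a] and
    [red_coef i l b].  A line through a point where [other_powers i] vanishes,
    transversal to its zero locus there and not contained in the zero loci of
    these two coefficients, reduces the claim to [kummer_domain]. *)
Lemma cone_irreducible (a b : {mpoly K[4]}) : @vanish K (a * b) ->
  vanish a \/ vanish b.
Proof.
move=> ab; pose i : 'I_4 := ord0.
have nf0 (g : {mpoly K[4]}) : (forall k : 'I_4, red_coef i k g = 0) -> vanish g.
  by move=> g0 v cv; rewrite (red_coefE i _ cv) big1 // => k _;
    rewrite g0 meval0 mul0r.
have [[k ak]|a0] := pselect (exists k : 'I_4, red_coef i k a != 0); last first.
  left; apply: nf0 => k; apply/eqP; apply: contraT => ak.
  by case: a0; exists k.
have [[l bl]|b0] := pselect (exists l : 'I_4, red_coef i l b != 0); last first.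
  right; apply: nf0 => l; apply/eqP; apply: contraT => bl.
  by case: b0; exists l.
exfalso.
have E r : mul_red i a b r = 0.
  move: r; apply: (red_coef_unique (fun r => @mul_red_free i a b r)) => v cv.
  by rewrite mul_redE // ab.
(* The base point of the line is (0, 1, rho, 0), on which the sum of the last
   three fourth powers vanishes; [lam] is its differential there, up to the
   factor 4. *)
pose rho : K := 4.-root (-1); have rho4 : rho ^+ 4 = -1 by rewrite rootCK.
pose i1 : 'I_4 := lift ord0 ord0; pose i2 : 'I_4 := lift ord0 (lift ord0 ord0).
pose lam : {mpoly K[4]} := 'X_i1 + rho ^+ 3 *: 'X_i2.
have lam0 : lam != 0.
  apply/eqP => /(congr1 (meval (fun j => (j == i1)%:R))).
  rewrite meval0 mevalD mevalZ !mevalXU => /eqP.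
  by rewrite /= mulr0 addr0 oner_eq0.
have [r] : exists r, (red_coef i k a * red_coef i l b * lam).@[r] != 0.
  by apply: mpoly_eval_neq0; rewrite !mulf_neq0.
rewrite !mevalM !mulf_eq0 !negb_or -andbA => /and3P[ar br lr].
pose u (j : 'I_4) := if j == i1 then 1 else if j == i2 then rho else 0.
pose e j := r j - u j.
have at1 g : (line u e g).[1] = g.@[r].
  by rewrite horner_line; apply: meval_eq => j; rewrite mul1r addrC subrK.
have line0 g : g.@[r] != 0 -> line u e g != 0.
  by apply: contraNneq => g0; rewrite -at1 g0 horner0.
pose q := line u e (- other_powers K i).
have dq : ~~ root q^`() 0.
  rewrite rootE /q /line mmapN -/(line _ _ _) line_other_powers.
  rewrite derivN raddf_sum hornerN horner_sum oppr_eq0.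
  under eq_bigr do rewrite /= deriv_linear_exp4.
  rewrite big_mkcond !big_ord_recl big_ord0 /= /e /u /=.
  set s := (X in X != 0); suff -> : s = 4%:R * lam.@[r]
    by rewrite mulf_neq0 ?pnatr_eq0.
  rewrite /s mevalD mevalZ !mevalXU /i2 /i1; ring: rho4.
have mupq : mup 0 q = 1%N.
  apply: mup_simple_root dq.
  rewrite rootE /q /line mmapN -/(line _ _ _) line_other_powers.
  rewrite hornerN horner_sum; under eq_bigr do rewrite horner_exp !hornerE.
  rewrite big_mkcond !big_ord_recl big_ord0 /u /=.
  by rewrite rho4 expr1n expr0n /= !addr0 add0r subrr oppr0.
have q0 : q != 0 by apply: contraNneq dq => ->; rewrite deriv0 root0.
apply: (@kummer_domain K q (fun k => line u e (red_coef i k a))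
  (fun l => line u e (red_coef i l b)) k l mupq q0 (line0 _ ar) (line0 _ br)) =>
    r'.
have := congr1 (line u e) (E r'); rewrite /line /mul_red mmap0 rmorph_sum;
  apply: etrans.
apply: eq_bigr => k' _ /=; rewrite [RHS]rmorph_sum; apply: eq_bigr => l' _ /=.
by case: eqP => _; rewrite ?mmap0 // !rmorphM rmorphXn.
Qed.
End Irreducible.

(** * Normality of the cone *)

Section Composition.
Local Open Scope ring_scope.

Lemma dhomog_comp (R : comNzRingType) n k (g : {mpoly R[n]})
    (lq : n.-tuple {mpoly R[k]}) (D d : nat) :
  g \is D.-homog -> (forall i, tnth lq i \is d.-homog) ->
  g \mPo lq \is (d * D).-homog.
Proof.
move=> /dhomogP hg hl; rewrite comp_mpolyEX big_seq; apply: rpred_sum => m mg.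
apply: dhomogZ; rewrite comp_mpolyX -(hg m mg) /= mdegE big_distrr /=.
elim/big_rec2: _ => [|i e p _ he]; first exact: dhomog1.
by apply: dhomogM => //; apply: dhomogMn.
Qed.

End Composition.

Section Normal.
Local Open Scope ring_scope.
Context (K : numClosedFieldType).
Implicit Types (g c d N D E : {mpoly K[4]}) (v u e : 'I_4 -> K) (i : 'I_4).

(** For [z] a fourth root of unity this is an automorphism of the cone over the
    space of the remaining coordinates. *)
Definition rescale i (z : K) g : {mpoly K[4]} :=
  g \mPo [tuple if l == i then z *: 'X_l else 'X_l | l < 4].

Lemma rescaleE i z g v : (rescale i z g).@[v] = g.@[set_coord v i (z * v i)].
Proof.
rewrite comp_mpoly_meval; apply: meval_eq => l; rewrite tnth_mktuple /set_coord.
by case: eqP => [->|_]; rewrite ?mevalZ mevalXU.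
Qed.

Lemma rescale_homog i z g (d : nat) : g \is d.-homog ->
  rescale i z g \is d.-homog.
Proof.
move=> hg; rewrite -[d]mul1n; apply: dhomog_comp => // l; rewrite tnth_mktuple.
have hX : 'X_l \is [in K[4], 1.-homog for mdeg] by rewrite dhomogX /= mdeg1.
by case: eqP => _ //; apply: dhomogZ.
Qed.

Lemma i_exp4 (j : nat) : ('i ^+ j : K) ^+ 4 = 1.
Proof. by rewrite -exprM mulnC exprM (exprM _ 2 2) sqrCi sqrrN !expr1n. Qed.

Lemma cone_set_coord v i z : cone v -> z ^+ 4 = 1 ->
  cone (set_coord v i (z * v i)).
Proof.
by move=> /(coneP i) cv z4; apply/(coneP i);
  rewrite set_coordE free_of_other_powers exprMn z4 mul1r.
Qed.

Lemma vanish_prod I (r : seq I) (F : I -> {mpoly K[4]}) :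
  vanish (\prod_(j <- r) F j) -> exists2 j, List.In j r & vanish (F j).
Proof.
elim: r => [|j r IH].
  rewrite big_nil => /(_ (fun=> 0)); rewrite meval1 /cone.
  rewrite big1 => [/(_ erefl)/eqP|i _]; first by rewrite oner_eq0.
  by rewrite expr0n.
rewrite big_cons => /cone_irreducible[vj|/IH[j' j'r vj']].
  by exists j => //; left.
by exists j' => //; right.
Qed.

Lemma vanish_rescale i (j : nat) g : vanish (rescale i ('i ^+ j) g) -> vanish g.
Proof.
move=> vg v cv; pose z : K := 'i ^+ j; have z4 : z ^+ 4 = 1 by exact: i_exp4.
have := vg (set_coord v i (z ^+ 3 * v i)); rewrite rescaleE => <-; last first.
  by apply: cone_set_coord => //; rewrite -exprM mulnC exprM z4 expr1n.
apply: meval_eq => l; rewrite /set_coord eqxx; case: eqP => // ->.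
by rewrite mulrA -exprS z4 mul1r.
Qed.

Definition norm_cofactor i D : {mpoly K[4]} :=
  \prod_(j < 3) rescale i ('i ^+ j.+1) D.

(** On the cone this is the product of the four conjugates of [D], written without
    the variable [X_i]. *)
Definition kummer_norm i D := red_coef i 0 (D * norm_cofactor i D).

Lemma kummer_norm_homog i D (d : nat) : D \is d.-homog ->
  kummer_norm i D \is (d + (d + (d + d))).-homog.
Proof.
move=> hD; rewrite -[(d + _)%N]subn0; apply: red_coef_homog;
  apply: dhomogM => //.
rewrite /norm_cofactor !big_ord_recl big_ord0 mulr1.
by do !apply: dhomogM; apply: rescale_homog.
Qed.

Lemma i_expS4 k : 'i ^+ k.+4 = 'i ^+ k :> K.
Proof. by rewrite -(addn4 k) exprD (i_exp4 1) mulr1. Qed.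

Lemma mul_norm_cofactor_invariant i D v (j : 'I_4) :
  (D * norm_cofactor i D).@[set_coord v i ('i ^+ j * v i)] =
    (D * norm_cofactor i D).@[v].
Proof.
pose h k := D.@[set_coord v i ('i ^+ k * v i)].
have hS4 k : h k.+4 = h k by rewrite /h i_expS4.
have E k : (D * norm_cofactor i D).@[set_coord v i ('i ^+ k * v i)] =
    h k * (h k.+1 * (h k.+2 * h k.+3)).
  rewrite mevalM /norm_cofactor !big_ord_recl big_ord0 mulr1 !mevalM !rescaleE
    /= /h.
  congr (_ * (_ * (_ * _))); apply: meval_eq => l; rewrite /set_coord eqxx;
    by case: eqP => // _; rewrite mulrA -exprD.
transitivity (D * norm_cofactor i D).@[set_coord v i ('i ^+ 0 * v i)];
  last first.
  by apply: meval_eq => l; rewrite /set_coord mul1r; case: eqP => // ->.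
rewrite !E; case: j => [[|[|[|[|j]]]] lj] //=; rewrite !hS4; ring.
Qed.

(** The product of all conjugates is invariant under the Galois action, so that
    averaging its reduction over the conjugates leaves only the term [k = 0]. *)
Lemma kummer_normE i D v : cone v -> (kummer_norm i D).@[v] =
  (D * norm_cofactor i D).@[v].
Proof.
move=> cv; have := sum_powers_of_i (fun l =>
  (red_coef i l (D * norm_cofactor i D)).@[v]) ord0 (v i).
rewrite expr0 mulr1 (eq_bigr (fun=> (D * norm_cofactor i D).@[v])) => [|j _].
  rewrite sumr_const card_ord -[LHS]mulr_natl => /mulfI/esym-> //.
  by rewrite pnatr_eq0.
rewrite subn0 exprM i_exp4 mul1r -(mul_norm_cofactor_invariant _ _ _ j).
rewrite (red_coefE i); last by apply: cone_set_coord => //; apply: i_exp4.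
by apply: eq_bigr => l _; rewrite red_coef_free set_coordE.
Qed.

Lemma kummer_norm_neq0 i D : ~ vanish D -> kummer_norm i D != 0.
Proof.
move=> vD; apply/eqP => n0.
have : vanish (D * norm_cofactor i D) by move=> v cv;
  rewrite -kummer_normE // n0 meval0.
by case/cone_irreducible => // /vanish_prod[j _ /vanish_rescale].
Qed.

Lemma norm_le1 (x : K) (R : K) : 0 <= R -> `|x| ^+ 4 <= R -> `|x| <= 1 + R.
Proof.
move=> R0 xR; have [x1|x1] := real_ltP (normr_real x) (@real1 K).
  by rewrite ltW // (lt_le_trans x1) // lerDl.
by rewrite (le_trans _ (_ : `|x| ^+ 4 <= _)) ?(le_trans xR) ?lerDr ?ler01 //
  ler_eXnr.
Qed.

(** The quotient [N / D] is bounded on bounded subsets of the cone.  The product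
    form of the inequality makes it meaningful where [D] vanishes. *)
Definition bounded_on_cone N D := forall rho : K, exists2 M, 0 <= M &
  forall v, cone v -> (forall i, `|v i| <= rho) -> `|N.@[v]| <= M * `|D.@[v]|.

(** A bound for the quotient at all conjugates of a point bounds, by Fourier
    inversion, each term [b_k x^k] of the numerator.  The missing factor
    [x^(4 - k)] is bounded too, and [x^4] is [- other_powers i]: this turns the
    estimate into one between polynomials free of [X_i], valid at every point of
    the affine space. *)
Lemma red_coef_bounded i N D (k : 'I_4) : bounded_on_cone N D ->
  forall rho : K, exists2 M, 0 <= M & forall u, (forall i, `|u i| <= rho) ->
    `|(red_coef i k (N * norm_cofactor i D) * other_powers K i).@[u]| <= M *
      `|(kummer_norm i D).@[u]|.
Proof.
(* Coordinates bounded by [rho] remain bounded by [R] when [u] is replaced by any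
   of the four points of the cone over it. *)
move=> bnd rho; pose R : K := `|rho| + (1 + 3%:R * `|rho| ^+ 4).
have R0 : 0 <= 3%:R * `|rho| ^+ 4 by rewrite mulr_ge0 ?ler0n ?exprn_ge0.
have R1 : 1 <= R by rewrite -[1]add0r lerD // lerDl.
have [M M0 leM] := bnd R.
exists (M * R ^+ 4); first by rewrite mulr_ge0 ?exprn_ge0 // (le_trans _ R1).
move=> u u_rho; have [x cx x4] := cone_lift u i.
have u_le j : `|u j| <= `|rho|.
  by rewrite (le_trans (u_rho j)) // real_ler_norm // ger0_real // (le_trans _
    (u_rho j)).
have xR : `|x| <= R.
  rewrite (@le_trans _ _ (1 + 3%:R * `|rho| ^+ 4)) ?lerDr //.
  apply: norm_le1 => //; rewrite -normrX x4 normrN meval_other_powers.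
  apply: le_trans (ler_norm_sum _ _ _) _.
  apply: (@le_trans _ _ (\sum_(j | j != i) `|rho| ^+ 4)).
    by apply: ler_sum => j _; rewrite normrX lerXn2r ?nnegrE.
  by rewrite sumr_const cardC1 card_ord mulr_natl.
have i_norm (j : nat) : `|'i ^+ j| = 1 :> K by rewrite normrX normCi expr1n.
have le_at (j : 'I_4) : let v := set_coord u i ('i ^+ j * x) in
    `|(N * norm_cofactor i D).@[v]| <= M * `|(kummer_norm i D).@[u]|.
  have cv : cone (set_coord u i ('i ^+ j * x)).
    have := cone_set_coord i cx (i_exp4 j); rewrite set_coordE; congr cone;
      apply/funext => l.
    by rewrite /set_coord; case: eqP.
  have nv : (kummer_norm i D).@[u] =
    (kummer_norm i D).@[set_coord u i ('i ^+ j * x)] by rewrite red_coef_free.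
  rewrite /= nv kummer_normE // !mevalM !normrM mulrA ler_wpM2r //.
  apply: leM => // l; rewrite /set_coord; case: eqP => _; first
    by rewrite normrM i_norm mul1r.
  by rewrite (le_trans (u_le l)) // lerDl addr_ge0.
have : `|(red_coef i k (N * norm_cofactor i D)).@[u] * x ^+ k| <= M *
  `|(kummer_norm i D).@[u]|.
  rewrite -(ler_pM2l (_ : 0 < 4%:R)) ?ltr0n // -[in leLHS](ger0_norm (ler0n K
    4)) -normrM.
  rewrite -(sum_powers_of_i (fun l =>
    (red_coef i l (N * norm_cofactor i D)).@[u]) k x).
  apply: le_trans (ler_norm_sum _ _ _) _.
  rewrite [leRHS](_ : _ = \sum_(j < 4) M * `|(kummer_norm i D).@[u]|);
    last first.
    by rewrite sumr_const card_ord mulr_natl.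
  apply: ler_sum => j _; rewrite normrM i_norm mul1r.
  apply: le_trans (le_at j); rewrite le_eqVlt; apply/orP; left; apply/eqP.
  congr `|_|; rewrite (red_coefE i).
    by apply: eq_bigr => l _; rewrite red_coef_free set_coordE.
  have := cone_set_coord i cx (i_exp4 j); rewrite set_coordE; congr cone;
    apply/funext => l.
  by rewrite /set_coord; case: eqP.
move=> le_k; rewrite mevalM -[(other_powers K i).@[u]]opprK -x4 mulrN normrN.
have -> : x ^+ 4 = x ^+ k * x ^+ (4 - k) by rewrite -exprD subnKC // ltnW.
rewrite mulrA normrM [leRHS]mulrAC ler_pM //.
rewrite normrX (@le_trans _ _ (R ^+ (4 - k))) // ?lerXn2r ?nnegrE //.
  exact: le_trans R1.
by rewrite ler_weXn2l // leq_subr.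
Qed.

(** The factor [X_i^4] is the price of [red_coef_bounded], which bounds the
    coefficients only after multiplication by [other_powers i]. *)
Lemma cone_normal_at i N D (d : nat) : D \is d.-homog -> ~ vanish D ->
  bounded_on_cone N D -> exists g, vanish (N * 'X_i ^+ 4 - g * D).
Proof.
move=> hD vD bnd.
have dvd (k : 'I_4) : exists g, red_coef i k (N * norm_cofactor i D) *
  other_powers K i = g * kummer_norm i D.
  exact: mpoly_dvd_of_bounded (kummer_norm_homog i hD) (kummer_norm_neq0 i vD)
    (red_coef_bounded i k bnd).
have [g gE] := choice dvd.
exists (- \sum_(k < 4) g k * 'X_i ^+ k).
have cof0 : ~ vanish (norm_cofactor i D)
  by move=> /vanish_prod[j _ /vanish_rescale].
suff : vanish (norm_cofactor i D * (N * 'X_i ^+ 4 - (- \sum_(k < 4) g k * 'X_i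
  ^+ k) * D)).
  by case/cone_irreducible.
move=> v cv.
have e1 : (N * norm_cofactor i D).@[v] * v i ^+ 4 =
    - (\sum_(k < 4) (g k).@[v] * v i ^+ k) * (kummer_norm i D).@[v].
  rewrite (red_coefE i _ cv) ((coneP i v).1 cv) mulrN mulNr mulr_suml.
  rewrite [in RHS]mulr_suml.
  congr (- _); apply: eq_bigr => k _.
  by rewrite mulrAC -mevalM gE mevalM mulrAC.
have sE : (\sum_(k < 4) g k * 'X_i ^+ k).@[v] =
  \sum_(k < 4) (g k).@[v] * v i ^+ k.
  by rewrite raddf_sum; apply: eq_bigr => k _ /=;
    rewrite mevalM mevalXn mevalXU.
rewrite mevalM mevalB mevalM mevalXn mevalXU [(_ * D).@[v]]mevalM mevalN sE.
move: e1; rewrite kummer_normE // !mevalM => e1.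
rewrite mulrBr mulrA [_ * N.@[v]]mulrC e1; ring.
Qed.

(** [X_i] and [X_j] are coprime; on lines parallel to the [i]-th axis [X_j] is
    constant. *)
Lemma dvd_var4 i j a b : i != j -> a * 'X_j ^+ 4 = b * 'X_i ^+ 4 ->
  exists c, a = c * 'X_i ^+ 4.
Proof.
move=> ij ab; pose e (l : 'I_4) : K := (l == i)%:R.
apply: (@dvd_of_lines _ _ e 4 a _ 'X_j).
- by apply: (@dhomogMn _ _ mdeg 1 'X_i 4); rewrite dhomogX /= mdeg1.
- by rewrite mevalXn mevalXU /e eqxx expr1n oner_neq0.
- by apply/eqP => /(congr1 (meval (fun=> 1)))/eqP;
  rewrite mevalXU meval0 oner_eq0.
move=> u; rewrite mevalXU => uj.
have := congr1 (line u e) ab; rewrite lineM [RHS]lineM.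
have -> : line u e ('X_j ^+ 4) = (u j ^+ 4)%:P.
  rewrite /line rmorphXn /= mmapX mmap1U /e eq_sym (negPf ij) scale0r addr0.
  by rewrite rmorphXn.
move=> eE; rewrite -(@dvdpZr _ (u j ^+ 4)) ?expf_neq0 // -mul_polyC mulrC eE.
exact: dvdp_mull.
Qed.

Lemma var_not_vanish i : ~ @vanish K 'X_i.
Proof.
pose j := if i == ord0 then lift ord0 ord0 else ord0 : 'I_4.
have ij : i != j by rewrite /j; case: (eqVneq i ord0) => // ->.
have [x cx _] := @cone_lift K (fun l => (l == i)%:R) j.
move=> /(_ _ cx); rewrite mevalXU /set_coord (negPf ij) eqxx => /eqP.
by rewrite oner_eq0.
Qed.

Lemma vanishM_cancel (a b : {mpoly K[4]}) : ~ vanish a -> vanish (a * b) ->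
  vanish b.
Proof. by move=> na /cone_irreducible[]. Qed.

(** [N X_i^4 = g_i D] and [N X_j^4 = g_j D] give [g_i X_j^4 = g_j X_i^4] on the
    cone.  Reducing with respect to a third variable turns this into identities
    between polynomials, so [X_i^4] divides every coefficient of [g_i]. *)
Lemma cone_normal N D (d : nat) : D \is d.-homog -> ~ vanish D ->
  bounded_on_cone N D -> exists g, vanish (N - g * D).
Proof.
move=> hD vD bnd.
pose i : 'I_4 := ord0; pose j : 'I_4 := lift ord0 ord0.
pose k : 'I_4 := lift ord0 (lift ord0 ord0).
have [Y YE] : exists Y : 'I_4 -> {mpoly K[4]}, forall l, Y l = 'X_l ^+ 4.
  by exists (fun l => 'X_l ^+ 4).
have [gi giE] := cone_normal_at i hD vD bnd; rewrite -YE in giE.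
have [gj gjE] := cone_normal_at j hD vD bnd; rewrite -YE in gjE.
have Y0 l : ~ vanish (Y l).
  move=> vl; apply: (@var_not_vanish l) => v /vl;
    rewrite YE mevalXn mevalXU => /eqP.
  by rewrite expf_eq0 => /eqP.
have indepY l : l != k -> free_of k (Y l).
  by move=> lk v x; rewrite YE !mevalXn !mevalXU /set_coord (negPf lk).
have gij : vanish (gi * Y j - gj * Y i).
  apply: (vanishM_cancel vD) => v cv.
  have := giE v cv; have := gjE v cv; rewrite !(mevalB, mevalM) => /eqP + /eqP.
  rewrite !subr_eq0 => /eqP ej /eqP ei.
  rewrite mulrBr !mulrA ![D.@[v] * _]mulrC -ei -ej; ring.
have nfij (m : 'I_4) : red_coef k m gi * Y j = red_coef k m gj * Y i.
  apply/eqP; rewrite -subr_eq0; apply/eqP; move: m;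
    apply: (@red_coef_unique _ k).
    by move=> m v x; rewrite !(mevalB, mevalM) !red_coef_free !indepY.
  move=> v cv; have := gij v cv; rewrite !(mevalB, mevalM).
  rewrite (red_coefE k gi cv) (red_coefE k gj cv) !mulr_suml -sumrB => gE.
  rewrite -[RHS]gE; apply: eq_bigr => m _.
  by rewrite !(mevalB, mevalM); ring.
have dvd (m : 'I_4) : exists c, red_coef k m gi = c * Y i.
  have := nfij m; rewrite !YE; exact: dvd_var4.
have [c cE] := choice dvd.
exists (\sum_(m < 4) c m * 'X_k ^+ m).
apply: (vanishM_cancel (Y0 i)) => v cv.
have sE : (\sum_(m < 4) c m * 'X_k ^+ m).@[v] =
  \sum_(m < 4) (c m).@[v] * v k ^+ m.
  by rewrite raddf_sum; apply: eq_bigr => m _ /=;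
    rewrite mevalM mevalXn mevalXU.
have gisE : gi.@[v] = (Y i).@[v] * \sum_(m < 4) (c m).@[v] * v k ^+ m.
  rewrite (red_coefE k _ cv) mulr_sumr; apply: eq_bigr => m _.
  by rewrite cE mevalM; ring.
have := giE v cv; rewrite !(mevalB, mevalM) sE gisE.
by set s := \sum_(m < 4) _ => <-; ring.
Qed.

Lemma meval_homog g (d : nat) x v : g \is d.-homog ->
  g.@[fun l => x * v l] = x ^+ d * g.@[v].
Proof.
move/dhomogP => hg; rewrite !mevalE mulr_sumr big_seq [RHS]big_seq.
apply: eq_bigr => m mg; rewrite mulrCA; congr (_ * _).
rewrite -(hg m mg) /= mdegE.
elim/big_rec3: _ => [|l x1 x2 x3 _ ->]; first by rewrite mulr1.
by rewrite exprMn exprD; ring.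
Qed.

Lemma cone_scale x v : cone v -> cone (fun l => x * v l).
Proof.
rewrite /cone => cv; under eq_bigr do rewrite exprMn.
by rewrite -mulr_sumr cv mulr0.
Qed.

(** Comparing both sides on the line through 0 and [v] shows that only the linear
    part of the polynomial of [cone_normal] contributes. *)
Lemma cone_normal_linear N D (d : nat) :
  N \is (d.+1).-homog -> D \is d.-homog -> ~ vanish D -> bounded_on_cone N D ->
  exists l : 'I_4 -> K, forall v, cone v -> N.@[v] =
    (\sum_j l j * v j) * D.@[v].
Proof.
move=> hN hD vD bnd; have [g gE] := cone_normal hD vD bnd.
exists (fun j => g@_U_(j)) => v cv.
have E w : cone w -> N.@[w] = g.@[w] * D.@[w].
  by move/gE; rewrite mevalB mevalM => /eqP; rewrite subr_eq0 => /eqP.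
have [D0|D0] := eqVneq D.@[v] 0; first by rewrite E // D0 !mulr0.
pose P : {poly K} :=
  \sum_(m <- msupp g) (g@_m * \prod_j v j ^+ m j) *: 'X^(mdeg m).
have PE x : P.[x] = g.@[fun l => x * v l].
  rewrite horner_sum mevalE; apply: eq_bigr => m _; rewrite hornerZ hornerXn.
  rewrite -mulrA; congr (_ * _); rewrite mdegE.
  elim/big_rec3: _ => [|l x1 x2 x3 _ <-]; first by rewrite mulr1.
  by rewrite exprMn exprD; ring.
have : D.@[v] *: P - N.@[v] *: 'X = 0.
  apply: (@poly_eq0_eval_generic K _ 'X); first by rewrite polyX_eq0.
  move=> x; rewrite hornerX => x0; rewrite !hornerE PE.
  have := E _ (cone_scale x cv);
    rewrite !(meval_homog _ _ hN, meval_homog _ _ hD).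
  rewrite exprSr -mulrA [g.@[_] * _]mulrCA => /(mulfI (expf_neq0 d x0)).
  by move=> e; rewrite mulrC -e; ring.
move/(congr1 (fun p : {poly K} => p`_1));
  rewrite coefB !coefZ coefX coef0 mulr1.
move/eqP; rewrite subr_eq0 => /eqP <-; rewrite mulrC; congr (_ * _).
rewrite coef_sum.
transitivity (\sum_(m <- msupp g) \sum_j (m == U_(j)%MM)%:R * (g@_U_(j) * v j)).
  apply: eq_bigr => m _; rewrite coefZ coefXn [1%N == _]eq_sym.
  have [/mdeg1P[j /eqP->]|dm] := boolP (mdeg m == 1%N); last first.
    rewrite mulr0 big1 // => j _; case: eqP => [mj|_]; last by rewrite mul0r.
    by rewrite mj mdeg1 in dm.
  rewrite [in RHS](bigD1 j) //= eqxx mul1r mulr1 [X in _ =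
    _ + X]big1 ?addr0 => [|l lj].
    rewrite (bigD1 j) //= mnm1E eqxx expr1 big1 ?mulr1 // => l lj.
    by rewrite mnm1E eq_sym (negPf lj).
  case: eqP => [/mnmP/(_ j)|]; last by rewrite mul0r.
  by rewrite !mnm1E eqxx (negPf lj).
rewrite exchange_big; apply: eq_bigr => j _ /=; rewrite -mulr_suml.
have [jg|jg] := boolP (U_(j)%MM \in msupp g); last first.
  by rewrite (memN_msupp_eq0 jg) mul0r mulr0.
rewrite (bigD1_seq _ jg (msupp_uniq g)) /= eqxx big1 ?addr0 ?mul1r // => m.
by move=> /negPf->.
Qed.

End Normal.

(** * Homologies preserving the quartic form *)

Section Homologies.
Local Open Scope ring_scope.
Context (K : numClosedFieldType).
Implicit Types (p l v w : 'I_4 -> K).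

Definition quartic v : K := \sum_i v i ^+ 4.
Definition lin_form l v : K := \sum_i l i * v i.
(** The linear map [v |-> v + l(v) p], a homology with centre the point spanned by
    [p], preserves the quartic form. *)
Definition symmetry p l := forall v, quartic (fun i =>
  v i + p i * lin_form l v) = quartic v.

Lemma quartic_taylor v p x : quartic (fun i => v i + p i * x) =
  quartic v + x * (4%:R * (\sum_i p i * v i ^+ 3) +
    6%:R * x * (\sum_i p i ^+ 2 * v i ^+ 2)
   + 4%:R * x ^+ 2 * (\sum_i p i ^+ 3 * v i) + x ^+ 3 * quartic p).
Proof.
rewrite /quartic !mulr_sumr -!big_split mulr_sumr -big_split.
by apply: eq_bigr => i _ /=; ring.
Qed.

(** The quotient of [F (v + l(v) p) - F(v)] by [l(v)]. *)
Definition polar p l v : K :=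
  4%:R * (\sum_i p i * v i ^+ 3) + 6%:R * lin_form l v * (\sum_i p i ^+ 2 * v i
    ^+ 2)
   + 4%:R * lin_form l v ^+ 2 * (\sum_i p i ^+ 3 * v i) +
     lin_form l v ^+ 3 * quartic p.

Lemma quartic_scale a v : quartic (fun i => a * v i) = a ^+ 4 * quartic v.
Proof. by rewrite /quartic mulr_sumr; apply: eq_bigr => i _;
  rewrite exprMn. Qed.

Lemma lin_form_scale l a v : lin_form l (fun i => a * v i) = a * lin_form l v.
Proof. by rewrite /lin_form mulr_sumr; apply: eq_bigr => i _;
  rewrite mulrCA. Qed.

Lemma lin_formD l v w : lin_form l (fun i => v i + w i) =
  lin_form l v + lin_form l w.
Proof. by rewrite /lin_form -big_split; apply: eq_bigr => i _;
  rewrite mulrDr. Qed.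

Definition lin_poly l : {mpoly K[4]} := \sum_i l i *: 'X_i.

Lemma lin_polyE l v : (lin_poly l).@[v] = lin_form l v.
Proof.
by rewrite raddf_sum; apply: eq_bigr => i _ /=; rewrite mevalZ mevalXU.
Qed.

Lemma lin_poly_homog l : lin_poly l \is 1.-homog.
Proof. by apply: rpred_sum => i _; apply: dhomogZ;
  rewrite dhomogX /= mdeg1. Qed.

Lemma lin_poly_eq0 l : lin_poly l = 0 -> l = fun=> 0.
Proof.
move=> l0; apply/funext => i; have := lin_polyE l (fun j => (j == i)%:R).
rewrite l0 meval0 /lin_form (bigD1 i) //= eqxx mulr1 big1 ?addr0 =>
  [->//|j /negPf->].
by rewrite mulr0.
Qed.

Definition polar_poly p l : {mpoly K[4]} :=
  4%:R *: (\sum_i p i *: 'X_i ^+ 3) + 6%:R *: lin_poly l * (\sum_i p i ^+ 2 *: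
    'X_i ^+ 2)
   + 4%:R *: lin_poly l ^+ 2 * lin_poly (fun i =>
     p i ^+ 3) + quartic p *: lin_poly l ^+ 3.

Lemma polar_polyE p l v : (polar_poly p l).@[v] = polar p l v.
Proof.
have sumE (n : nat) (a : 'I_4 -> K) :
    (\sum_i a i *: 'X_i ^+ n).@[v] = \sum_i a i * v i ^+ n.
  by rewrite raddf_sum; apply: eq_bigr => i _ /=;
    rewrite mevalZ mevalXn mevalXU.
rewrite /polar_poly !mevalD !mevalZ [(_ * \sum_i _).@[v]]mevalM [(_ * lin_poly
  _).@[v]]mevalM.
rewrite !mevalZ !mevalXn !sumE !lin_polyE /polar -/(lin_form (fun i =>
  p i ^+ 3) v) /=; ring.
Qed.

Lemma polar_poly_homog p l : polar_poly p l \is 3.-homog.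
Proof.
have hX i n : ('X_i ^+ n : {mpoly K[4]}) \is n.-homog.
  by rewrite -[X in X.-homog]mul1n; apply: dhomogMn; rewrite dhomogX /= mdeg1.
have hL n : lin_poly l ^+ n \is n.-homog.
  by rewrite -[X in X.-homog]mul1n; apply: dhomogMn; apply: lin_poly_homog.
have hS n (a : 'I_4 -> K) : \sum_i a i *: 'X_i ^+ n \is n.-homog.
  by apply: rpred_sum => i _; apply: dhomogZ.
rewrite /polar_poly; apply: rpredD; [apply: rpredD; [apply: rpredD|]|].
- exact: dhomogZ.
- by apply: (@dhomogM _ _ mdeg 1 _ 2) => //; apply: dhomogZ;
  apply: lin_poly_homog.
- by apply: (@dhomogM _ _ mdeg 2 _ 1); [apply: dhomogZ|apply: lin_poly_homog].
- exact: dhomogZ.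
Qed.

Lemma symmetryP p l : symmetry p l <-> lin_poly l = 0 \/ polar_poly p l = 0.
Proof.
split=> [gd|lp v].
  have /eqP : lin_poly l * polar_poly p l = 0.
    apply: mpoly_eq0_eval => v; rewrite mevalM lin_polyE polar_polyE.
    by have := gd v; rewrite quartic_taylor -[RHS]addr0 => /addrI.
  by rewrite mulf_eq0 => /orP[]/eqP; [left|right].
rewrite quartic_taylor -/(polar p l v) -lin_polyE -polar_polyE -mevalM.
by case: lp => ->; rewrite ?mulr0 ?mul0r meval0 addr0.
Qed.

(** On the cone the product of [l] and the polar cubic vanishes.  The cone is
    irreducible and lies on no plane or cubic, so one of them is 0. *)
Lemma symmetry_of_cone p l :
  (forall v, cone v -> cone (fun i => v i + p i * lin_form l v)) ->
    symmetry p l.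
Proof.
move=> stable; apply/symmetryP.
have : vanish (lin_poly l * polar_poly p l).
  move=> v cv; rewrite mevalM lin_polyE polar_polyE.
  by have := stable v cv; rewrite /cone -/(quartic _) quartic_taylor -/(polar p
    l v)
    [quartic v]cv add0r.
case/cone_irreducible => /vanish_small_degree.
  by move/(_ 1%N isT (lin_poly_homog l)); left.
by move/(_ 3 isT (polar_poly_homog p l)); right.
Qed.

(** The variable [h] is either of absolute value less than 1 or controlled by the
    leading term, of which all lower terms are at most a multiple. *)
Lemma root_bound (a h C c1 c2 c3 : K) : a != 0 -> 0 <= C ->
  `|c1| <= C -> `|c2| <= C -> `|c3| <= C ->
  h * (c1 + h * c2 + h ^+ 2 * c3 + h ^+ 3 * a) = 0 ->
  `|h| <= 1 + 3%:R * C / `|a|.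
Proof.
move=> a0 C0 b1 b2 b3 /eqP; have a_gt0 : 0 < `|a| by rewrite normr_gt0.
have C'0 : 0 <= 3%:R * C / `|a| by rewrite divr_ge0 ?mulr_ge0 ?ler0n.
have [h1|h1] := real_ltP (normr_real h) (@real1 K).
  by rewrite ltW // (lt_le_trans h1) // lerDl.
have hpos : 0 < `|h| by apply: lt_le_trans h1.
rewrite mulf_eq0 -normr_eq0 gt_eqF //= addrC addr_eq0 => /eqP e.
rewrite (@le_trans _ _ (3%:R * C / `|a|)) ?lerDr // ler_pdivlMr //.
have h2 : 0 < `|h| ^+ 2 by rewrite exprn_gt0.
rewrite -(ler_pM2l h2) mulrA -exprSr -normrX -normrM e normrN.
have le1 : 1 <= `|h| ^+ 2 by rewrite exprn_ege1.
have -> : `|h| ^+ 2 * (3%:R * C) = C * `|h| ^+ 2 + C * `|h| ^+ 2 + C * `|h| ^+ 2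
  by ring.
apply: le_trans (ler_normD _ _) _; apply: lerD; last first.
  by rewrite normrM normrX mulrC ler_pM2r.
apply: le_trans (ler_normD _ _) _; apply: lerD.
  by apply: (le_trans b1); rewrite ler_peMr.
by rewrite normrM mulrC ler_pM // ler_eXnr.
Qed.

Ltac nonneg := do !(first [exact: normr_ge0 | exact: ler0n |
  apply: exprn_ge0 | apply: addr_ge0 | apply: mulr_ge0]).

(** The quotient [h = N / D] satisfies F(v + h p) = 0, whose constant term F(v) is
    0 and whose leading coefficient is the constant F(p). *)
Lemma bounded_of_equation (N D : {mpoly K[4]}) p : quartic p != 0 ->
  (forall v, cone v -> quartic (fun i => D.@[v] * v i + p i * N.@[v]) = 0) ->
  bounded_on_cone N D.
Proof.
move=> p0 eqn rho; pose r := `|rho|.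
pose C := \sum_i (4%:R * (`|p i| * r ^+ 3) + 6%:R * (`|p i| ^+ 2 * r ^+ 2)
  + 4%:R * (`|p i| ^+ 3 * r)).
have C0 : 0 <= C.
  by apply: sumr_ge0 => i _; nonneg.
exists (1 + 3%:R * C / `|quartic p|).
  by rewrite addr_ge0 // divr_ge0 ?mulr_ge0 ?ler0n.
move=> v cv v_rho; have e := eqn v cv.
have vr i : `|v i| <= r.
  by rewrite (le_trans (v_rho i)) // real_ler_norm // ger0_real // (le_trans _
    (v_rho i)).
have [D0|D0] := eqVneq D.@[v] 0.
  have : quartic (fun i => N.@[v] * p i) = 0.
    by rewrite -e; congr quartic; apply/funext => i;
      rewrite D0 mul0r add0r mulrC.
  rewrite quartic_scale => /eqP;
    rewrite mulf_eq0 (negPf p0) orbF expf_eq0 => /eqP->.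
  by rewrite D0 normr0 mulr0.
pose h := N.@[v] / D.@[v].
have -> : N.@[v] = h * D.@[v] by rewrite divfK.
rewrite normrM ler_wpM2r //.
pose c1 := 4%:R * \sum_i p i * v i ^+ 3.
pose c2 := 6%:R * \sum_i p i ^+ 2 * v i ^+ 2.
pose c3 := 4%:R * \sum_i p i ^+ 3 * v i.
have bsum (k : nat) (f g : 'I_4 -> K) : (forall i, `|f i| <= g i) ->
    `|k%:R * \sum_i f i| <= \sum_i k%:R * g i.
  move=> fg; rewrite normrM normr_nat -mulr_sumr ler_wpM2l ?ler0n //.
  by apply: le_trans (ler_norm_sum _ _ _) _; apply: ler_sum.
have bX i n : `|v i ^+ n| <= r ^+ n
  by rewrite normrX lerXn2r ?nnegrE ?normr_ge0.
apply: (@root_bound (quartic p) h C c1 c2 c3) => //.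
- apply: (le_trans (bsum 4 _ (fun i => `|p i| * r ^+ 3) _)) => [i|].
    by rewrite normrM ler_wpM2l.
  by apply: ler_sum => i _; rewrite -addrA lerDl; nonneg.
- apply: (le_trans (bsum 6 _ (fun i => `|p i| ^+ 2 * r ^+ 2) _)) => [i|].
    by rewrite normrM normrX ler_wpM2l ?exprn_ge0.
  by apply: ler_sum => i _; rewrite addrAC lerDr; nonneg.
- apply: (le_trans (bsum 4 _ (fun i => `|p i| ^+ 3 * r) _)) => [i|].
    by rewrite normrM normrX ler_wpM2l ?exprn_ge0.
  by apply: ler_sum => i _; rewrite lerDr; nonneg.
have : quartic (fun i => v i + p i * h) = 0.
  apply: (mulfI (expf_neq0 4 D0)); rewrite mulr0 -quartic_scale -e;
    congr quartic.
  by apply/funext => i; rewrite mulrDr; congr (_ + _);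
    rewrite mulrCA /h [D.@[v] * _]mulrC divfK.
rewrite quartic_taylor [quartic v]cv add0r => <-; congr (_ * _).
by rewrite /c1 /c2 /c3; ring.
Qed.

Lemma homology_of_equation (N D : {mpoly K[4]}) p (d : nat) :
  N \is (d.+1).-homog -> D \is d.-homog -> ~ vanish D -> quartic p != 0 ->
  (forall v, cone v -> quartic (fun i => D.@[v] * v i + p i * N.@[v]) = 0) ->
  exists2 l, symmetry p l & forall v, cone v -> N.@[v] = lin_form l v * D.@[v].
Proof.
move=> hN hD vD p0 eqn.
have [l lE] := cone_normal_linear hN hD vD (bounded_of_equation p0 eqn).
exists l => //; apply: symmetry_of_cone.
pose Q := \sum_i ('X_i + p i *: lin_poly l) ^+ 4.
have QE v : Q.@[v] = quartic (fun i => v i + p i * lin_form l v).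
  rewrite raddf_sum; apply: eq_bigr => i _ /=.
  by rewrite mevalXn mevalD mevalXU mevalZ lin_polyE.
have [D4 D4E] : exists D4, D4 = D ^+ 4 by exists (D ^+ 4).
suff : vanish Q by move=> vQ v cv; rewrite /cone -/(quartic _) -QE vQ.
have : vanish (D4 * Q).
  move=> v cv; rewrite mevalM D4E mevalXn QE -quartic_scale -[RHS](eqn v cv);
    congr quartic.
  by apply/funext => i; rewrite lE // -/(lin_form l v); ring.
case/cone_irreducible => // vD4; case: vD => v /vD4.
by rewrite D4E mevalXn => /eqP; rewrite expf_eq0 => /eqP.
Qed.

End Homologies.

(** * Classification of the homologies *)

Section Classification.
Local Open Scope ring_scope.
Context (K : numClosedFieldType).
Implicit Types (p l v w : 'I_4 -> K) (i j k : 'I_4).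

Definition two_coords i j a b : 'I_4 -> K :=
  fun k => if k == i then a else if k == j then b else 0.

Lemma sum_two_coords i j a b (n : nat) (c : 'I_4 -> K) : i != j ->
  \sum_k c k * two_coords i j a b k ^+ n.+1 = c i * a ^+ n.+1 + c j * b ^+ n.+1.
Proof.
move=> ij; rewrite (bigD1 i) //= (bigD1 j) 1?eq_sym //= /two_coords eqxx.
rewrite eq_sym (negPf ij) eqxx big1 ?addr0 // => k /andP[/negPf-> /negPf->].
by rewrite expr0n mulr0.
Qed.

Lemma sum_two_coords1 i j a b (c : 'I_4 -> K) : i != j ->
  \sum_k c k * two_coords i j a b k = c i * a + c j * b.
Proof.
move=> ij; have := sum_two_coords a b 0 c ij; rewrite !expr1 => <-.
by apply: eq_bigr => k _; rewrite expr1.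
Qed.

Lemma polar_two_coords p l i j a b : i != j -> polar p l (two_coords i j a b) =
  4%:R * (p i * a ^+ 3 + p j * b ^+ 3)
  + 6%:R * (l i * a + l j * b) * (p i ^+ 2 * a ^+ 2 + p j ^+ 2 * b ^+ 2)
  + 4%:R * (l i * a + l j * b) ^+ 2 * (p i ^+ 3 * a + p j ^+ 3 * b)
  + (l i * a + l j * b) ^+ 3 * quartic p.
Proof.
by move=> ij; rewrite /polar /lin_form !(sum_two_coords1, sum_two_coords).
Qed.

Definition on_axis p := exists2 i, p i != 0 & forall j, j != i -> p j = 0.

Definition on_edge p := exists i j, [/\ i != j, p i != 0, p i ^+ 4 = p j ^+ 4 &
  forall k, k != i -> k != j -> p k = 0].

Lemma other_index i : exists j, i != j.
Proof.
by exists (if i == ord0 then ord_max else ord0); case: (eqVneq i ord0) => // ->.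
Qed.

Lemma polar_axis p l i : (forall v, polar p l v = 0) ->
  4%:R * p i + 6%:R * l i * p i ^+ 2 + 4%:R * l i ^+ 2 * p i ^+ 3 +
    l i ^+ 3 * quartic p = 0.
Proof.
have [j ij] := other_index i.
by move=> /(_ (two_coords i j 1 0)); rewrite polar_two_coords // => <-; ring.
Qed.

Lemma polar_support p l i : quartic p != 0 -> (forall v, polar p l v = 0) ->
  (l i == 0) = (p i == 0).
Proof.
move=> p0 /(polar_axis i) e; apply/eqP/eqP => x0; move/eqP: e; rewrite x0.
  by rewrite !(mulr0, mul0r, expr0n, addr0) mulf_eq0 pnatr_eq0 => /eqP.
rewrite !(mulr0, expr0n, addr0, add0r) mulf_eq0 (negPf p0) orbF.
by rewrite expf_eq0 => /eqP.
Qed.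

(** On the plane [l = 0] only the term [4 sum_i p_i v_i^3] of the polar is left;
    it is evaluated at the point of the plane on the edge [i j]. *)
Lemma polar_ratio p l i j : quartic p != 0 -> (forall v, polar p l v = 0) ->
  l i != 0 -> l j != 0 -> p i / l i ^+ 3 = p j / l j ^+ 3.
Proof.
move=> p0 pol li lj; have [->//|ij] := eqVneq i j.
have := pol (two_coords i j (l i)^-1 (- (l j)^-1)); rewrite polar_two_coords //.
rewrite mulrN !divff // subrr !(mulr0, mul0r, expr0n, addr0) => /eqP.
rewrite mulf_eq0 pnatr_eq0 /= => /eqP e; apply/eqP; rewrite -subr_eq0;
  apply/eqP.
by rewrite -e -!exprVn; ring.
Qed.

(** If three coordinates of [l] were nonzero, the point (1/l_i, 1/l_j, -2/l_k) of
    the plane [l = 0] would give 1 + 1 - 8 = 0, as [p_i / l_i^3] is the same for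
    the three indices. *)
Lemma polar_edge p l : quartic p != 0 -> (forall v, polar p l v = 0) ->
  forall i j k, i != j -> j != k -> i != k -> l i != 0 -> l j != 0 -> l k = 0.
Proof.
move=> p0 pol i j k ij jk ik li lj; apply/eqP; apply: contraT => lk.
pose v m := if m == k then - 2%:R / l k else two_coords i j (l i)^-1 (l j)^-1 m.
have sumv (n : nat) (c : 'I_4 -> K) : \sum_m c m * v m ^+ n.+1 =
    c k * (- 2%:R / l k) ^+ n.+1 + (c i / l i ^+ n.+1 + c j / l j ^+ n.+1).
  rewrite (bigD1 k) //= {1}/v eqxx; congr (_ + _).
  rewrite (bigD1 i) //= (bigD1 j) /=; last by rewrite jk eq_sym.
  rewrite /v /two_coords (negPf ik) (negPf jk) !eqxx eq_sym (negPf ij) !exprVn.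
  rewrite big1 ?addr0 // => m /andP[/andP[/negPf-> /negPf->] /negPf->].
  by rewrite expr0n mulr0.
have lv0 : lin_form l v = 0.
  have := sumv 0 l; rewrite /lin_form; under eq_bigr do rewrite expr1.
  by move=> ->; rewrite !expr1 !divff // mulrC divfK //; ring.
have := pol v; rewrite /polar lv0 sumv !(mulr0, mul0r, expr0n, addr0) /= =>
  /eqP.
rewrite (polar_ratio p0 pol li lk) (polar_ratio p0 pol lj lk).
have -> : 4%:R * (p k * (- 2%:R / l k) ^+ 3 + (p k / l k ^+ 3 +
  p k / l k ^+ 3)) =
    - 24%:R * p k / l k ^+ 3 by rewrite -!exprVn; ring.
rewrite !mulf_eq0 oppr_eq0 pnatr_eq0 invr_eq0 expf_eq0 (negPf lk) /= orbF.
by rewrite -(polar_support k p0 pol) (negPf lk).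
Qed.

(** With [a = l_i p_i] and [b = l_j p_j], the restriction of the polar to an edge is
    a binary cubic with coefficients in [a] and [b] only, and three of its values
    give [a = b = -1]. *)
Lemma symmetry_cases p l : quartic p != 0 -> symmetry p l ->
  (exists i, l i != 0) ->
  (exists i, [/\ p i != 0, forall j, j != i -> p j = 0,
                 forall j, j != i -> l j = 0 & (1 + l i * p i) ^+ 4 = 1]) \/
  (exists i j, [/\ i != j, p i != 0, p i ^+ 4 = p j ^+ 4,
                 forall k, k != i -> k != j -> p k = 0 &
                 l = two_coords i j (- (p i)^-1) (- (p j)^-1)]).
Proof.
move=> p0 /symmetryP[/lin_poly_eq0->|pol0] [i li]; first by rewrite eqxx in li.
have pol v : polar p l v = 0 by rewrite -polar_polyE pol0 meval0.
have supp k := polar_support k p0 pol.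
have pi0 : p i != 0 by rewrite -supp.
have [[j ji lj]|single] := pselect (exists2 j, j != i & l j != 0); last first.
  have l0 j : j != i -> l j = 0.
    by move=> ji; apply/eqP; apply: contraT => lj; case: single; exists j.
  have pj0 j : j != i -> p j = 0 by move=> ji; apply/eqP; rewrite -supp l0.
  left; exists i; split => //.
  have phip : quartic p = p i ^+ 4.
    by rewrite /quartic (bigD1 i) //= big1 ?addr0 // => j /pj0->;
      rewrite expr0n.
  have := polar_axis i pol; rewrite phip => e; apply/eqP; rewrite -subr_eq0;
    apply/eqP.
  by rewrite -[RHS](mulr0 (l i)) -e; ring.
have ij : i != j by rewrite eq_sym.
have l0 k : k != i -> k != j -> l k = 0.
  by move=> ki kj; apply: (polar_edge p0 pol (i := i) (j := j));
    rewrite // eq_sym.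
have pk0 k : k != i -> k != j -> p k = 0.
  by move=> ki kj; apply/eqP; rewrite -supp l0.
have pj0 : p j != 0 by rewrite -supp.
pose mu := p i / l i ^+ 3; have mu0 : mu != 0
  by rewrite mulf_neq0 ?invr_eq0 ?expf_neq0.
have piE : p i = mu * l i ^+ 3 by rewrite divfK ?expf_neq0.
have pjE : p j = mu * l j ^+ 3.
  by rewrite /mu (polar_ratio p0 pol li lj) divfK ?expf_neq0.
pose a := l i * p i; pose b := l j * p j.
have phip : quartic p = mu * (a ^+ 3 + b ^+ 3).
  rewrite /quartic (bigD1 i) //= (bigD1 j) //= big1 => [|k /andP[ki kj]].
    rewrite addr0 /a /b !exprS !expr0; rewrite {1}piE {2}pjE; ring.
  by rewrite pk0 // expr0n.
(* [mu * G s t] is the value of the polar at (s / l_i, t / l_j). *)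
pose G s t := 4%:R * (s ^+ 3 + t ^+ 3) + 6%:R * (s + t) * (a * s ^+ 2 +
  b * t ^+ 2)
  + 4%:R * (s + t) ^+ 2 * (a ^+ 2 * s + b ^+ 2 * t) + (s + t) ^+ 3 * (a ^+ 3 +
    b ^+ 3).
have E s t : G s t = 0.
  have := pol (two_coords i j (s / l i) (t / l j));
    rewrite polar_two_coords // phip => e.
  apply: (mulfI mu0); rewrite mulr0 -e /G /a /b piE pjE; field.
  by rewrite li lj.
(* The combination that eliminates the terms of degree 2 and 3 in [a], [b]. *)
have e1 : 12%:R * (a + b + 2%:R) = 4%:R * G 1 0 + 4%:R * G 0 1 - G 1 1.
  by rewrite /G; ring.
have ba : b = - 2%:R - a.
  move/eqP: e1; rewrite !E !mulr0 addr0 subr0 mulf_eq0 pnatr_eq0 /= => /eqP e.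
  by rewrite -[b]subr0 -e; ring.
have a1 : a = -1.
  have e2 : - 4%:R * (a + 1) = G 1 0 - G 0 1 by rewrite /G ba; ring.
  move/eqP: e2; rewrite !E subr0 mulf_eq0 oppr_eq0 pnatr_eq0 /= addr_eq0.
  by move/eqP.
have b1 : b = -1 by rewrite ba a1; ring.
have l4 : l i ^+ 4 = l j ^+ 4.
  apply: (mulfI mu0); transitivity a; first by rewrite /a piE; ring.
  by rewrite a1 -b1 /b pjE; ring.
right; exists i, j; split => //.
  apply: (mulfI (expf_neq0 4 li)); rewrite -exprMn -/a {1}l4 -exprMn -/b.
  by rewrite a1 b1.
apply/funext => k; rewrite /two_coords.
have [->|ki] := eqVneq k i; first by apply: (mulIf pi0); rewrite mulNr mulVf.
have [->|kj] := eqVneq k j; first by apply: (mulIf pj0); rewrite mulNr mulVf.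
exact: l0.
Qed.

End Classification.

(** * The number of homologies with a given centre *)

Section CardRange.
Local Open Scope ring_scope.
Local Open Scope classical_set_scope.
Local Open Scope card_scope.

Lemma card_range (T : finType) (U : Type) (f : T -> U) (n : nat) :
  injective f -> #|T| = n -> range f #= `I_n.
Proof.
move=> f_inj <-; have := @card_II #|T|; rewrite card_eq_sym => cardI.
have -> : range f = range (f \o enum_val (A := T)).
  apply/seteqP; split=> [_ [x _ <-]|_ [k _ <-]]; last by exists (enum_val k).
  by exists (enum_rank x) => //=; rewrite enum_rankK.
apply: card_eq_trans cardI; apply: inj_card_eq => k l _ _ /= /f_inj.
exact: enum_val_inj.
Qed.

End CardRange.

Section SymmetryCount.
Local Open Scope ring_scope.
Local Open Scope classical_set_scope.
Local Open Scope card_scope.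
Context (K : numClosedFieldType).
Implicit Types (p l v w : 'I_4 -> K) (i j k : 'I_4).

Lemma i_pow_inj i j : 'i ^+ i = 'i ^+ j :> K -> i = j.
Proof.
have m1 : (-1 : K) != 1 by rewrite -subr_eq0 -opprD oppr_eq0 -mulr2n pnatr_eq0.
have i1 : 'i != 1 :> K.
  by apply: contra_neq m1 => i1; rewrite -(sqrCi K) i1 expr1n.
have i3 : 'i ^+ 3 != 1 :> K.
  apply: contra_neq i1 => i3; rewrite -[LHS]mulr1 -i3 -exprS.
  by rewrite (exprM _ 2 2) sqrCi sqrrN expr1n.
wlog lt : i j / (i <= j)%N.
  by move=> wl; case: (leqP i j) => [/wl//|/ltnW/wl h] /esym/h.
rewrite -(subnKC lt) exprD -[LHS]mulr1 => /(mulfI (expf_neq0 _ (neq0Ci K))) e.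
apply/val_inj/eqP; rewrite eqn_leq lt /= -subn_eq0; apply/eqP.
have : (j - i < 4)%N by rewrite (leq_ltn_trans (leq_subr _ _)).
case: (j - i)%N e => [|[|[|[|d]]]] // /esym/eqP; rewrite ?sqrCi ?expr1.
- by rewrite (negPf i1).
- by rewrite (negPf m1).
- by rewrite (negPf i3).
Qed.

Lemma fourth_root_of_unity (z : K) : z ^+ 4 = 1 -> exists k, z = 'i ^+ k.
Proof.
move=> z4; have : (z - 1) * ((z - 'i) * ((z + 1) * (z + 'i))) == 0.
  have i2 : 'i ^+ 2 = -1 :> K by exact: sqrCi.
  by apply/eqP; transitivity (z ^+ 4 - 1); [ring: i2|rewrite z4 subrr].
rewrite !mulf_eq0 !subr_eq0 !addr_eq0 => /or4P[] /eqP->.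
- by exists ord0.
- by exists (lift ord0 ord0); rewrite expr1.
- by exists (lift ord0 (lift ord0 ord0)); rewrite sqrCi.
- by exists ord_max; rewrite /= exprS sqrCi mulrN1.
Qed.

Lemma symmetry0 p : symmetry p (fun=> 0).
Proof.
move=> v; congr quartic; apply/funext => i.
by rewrite /lin_form big1 ?mulr0 ?addr0 // => j _; rewrite mul0r.
Qed.

Definition axis_form p i (z : K) : 'I_4 -> K :=
  fun j => if j == i then (z - 1) / p i else 0.

Lemma symmetry_axis p i z : p i != 0 -> (forall j, j != i -> p j = 0) ->
  z ^+ 4 = 1 ->
  symmetry p (axis_form p i z).
Proof.
move=> pi0 pj0 z4 v; have -> : lin_form (axis_form p i z) v =
  (z - 1) / p i * v i.
  rewrite /lin_form (bigD1 i) //= {1}/axis_form eqxx big1 ?addr0 // =>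
    j /negPf ji.
  by rewrite /axis_form ji mul0r.
apply: eq_bigr => j _; have [->|ji] := eqVneq j i; last
  by rewrite pj0 // mul0r addr0.
have -> : v i + p i * ((z - 1) / p i * v i) = z * v i by field.
by rewrite exprMn z4 mul1r.
Qed.

Lemma card_symmetry_axis p : on_axis p -> [set l | symmetry p l] #= `I_4.
Proof.
move=> [i pi0 pj0].
have -> : [set l | symmetry p l] =
  range (fun k : 'I_4 => axis_form p i ('i ^+ k)).
  apply/seteqP; split=> [l gl|_ [k _ <-]]; last first.
    by apply: symmetry_axis => //; apply: i_exp4.
  have phip : quartic p != 0.
    rewrite /quartic (bigD1 i) //= big1 ?addr0 ?expf_neq0 // => j /pj0->.
    by rewrite expr0n.
  have [lnz|l0] := pselect (exists i, l i != 0); last first.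
    exists ord0 => //; apply/funext => j;
      rewrite /axis_form expr0 subrr mul0r if_same.
    by apply/esym/eqP; apply: contraT => lj; case: l0; exists j.
  have [[i' [pi' pj' lj' e]]|[i' [j' [ij' pi' pij _ _]]]] :=
    symmetry_cases phip gl lnz.
    have ii' : i' = i by apply/eqP; apply: contraT => /pj0 pi'0;
      rewrite pi'0 eqxx in pi'.
    move: e lj'; rewrite ii' => /fourth_root_of_unity[k ek] lj'.
    exists k => //; apply/funext => j; rewrite /axis_form;
      case: (eqVneq j i) => [->|/lj'//].
    by rewrite -ek addrC addKr mulfK.
  have ii' : i' = i by apply/eqP; apply: contraT => /pj0 pi'0;
    rewrite pi'0 eqxx in pi'.
  have : p j' = 0 by apply: pj0; rewrite -ii' eq_sym.
  move=> pj0'; move/eqP: pij; rewrite pj0' expr0n expf_eq0 (negPf pi') andbF.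
  by [].
apply: card_range => [k l /(congr1 (fun f => f i))|]; last exact: card_ord.
rewrite /axis_form eqxx => /(divIf pi0)/addIr; exact: i_pow_inj.
Qed.

(** This map exchanges, up to fourth roots of unity, the coordinates [i] and [j]. *)
Lemma symmetry_edge p i j : i != j -> p i != 0 -> p i ^+ 4 = p j ^+ 4 ->
  (forall k, k != i -> k != j -> p k = 0) ->
  symmetry p (two_coords i j (- (p i)^-1) (- (p j)^-1)).
Proof.
move=> ij pi0 pij pk0 v.
have pj0 : p j != 0.
  apply: contraNneq pi0 => pj0; move/eqP: pij.
  by rewrite pj0 expr0n expf_eq0.
have -> : lin_form (two_coords i j (- (p i)^-1) (- (p j)^-1)) v =
  - (v i / p i + v j / p j).
  rewrite /lin_form; under eq_bigr do rewrite mulrC; rewrite sum_two_coords1 //;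
    ring.
rewrite /quartic (bigD1 i) //= (bigD1 j) 1?eq_sym //= [RHS](bigD1 i) //=.
rewrite [in RHS](bigD1 j) 1?eq_sym //= !addrA; congr (_ + _); last first.
  by apply: eq_bigr => k /andP[ki kj]; rewrite pk0 // mul0r addr0.
have -> : v i + p i * - (v i / p i + v j / p j) = - (p i * (v j / p j))
  by field; rewrite pi0 pj0.
have -> : v j + p j * - (v i / p i + v j / p j) = - (p j * (v i / p i))
  by field; rewrite pi0 pj0.
have opp4 (x : K) : (- x) ^+ 4 = x ^+ 4 by ring.
have ej : (p i * (v j / p j)) ^+ 4 = v j ^+ 4
  by rewrite exprMn pij -exprMn mulrC divfK.
have ei : (p j * (v i / p i)) ^+ 4 = v i ^+ 4
  by rewrite exprMn -pij -exprMn mulrC divfK.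
by rewrite !opp4 ei ej addrC.
Qed.

Lemma on_edge_quartic p : on_edge p -> quartic p != 0.
Proof.
move=> [i [j [ij pi0 pij pk0]]]; rewrite /quartic (bigD1 i) //= (bigD1 j) /=;
  last by rewrite eq_sym.
rewrite big1 => [|k /andP[ki kj]]; last by rewrite pk0 // expr0n.
rewrite addr0 -pij (_ : _ + _ = 2%:R * p i ^+ 4); last by ring.
by rewrite mulf_neq0 ?pnatr_eq0 ?expf_neq0.
Qed.

Lemma on_axis_quartic p : on_axis p -> quartic p != 0.
Proof.
move=> [i pi0 pj0]; rewrite /quartic (bigD1 i) //= big1 ?addr0 ?expf_neq0 // =>
  j /pj0->.
by rewrite expr0n.
Qed.

Lemma on_edge_not_axis p : on_edge p -> ~ on_axis p.
Proof.
move=> [i [j [ij pi0 pij pk0]]] [k pk pl0].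
have ik : i = k by apply/eqP; apply: contraNT pi0 => /pl0->.
have jk : j != k by rewrite -ik eq_sym.
move/eqP: pij; rewrite (pl0 _ jk) expr0n expf_eq0 /=.
by rewrite (negPf pi0).
Qed.

Lemma card_symmetry_edge p : on_edge p -> [set l | symmetry p l] #= `I_2.
Proof.
move=> edge; have phip := on_edge_quartic edge.
have [i [j [ij pi0 pij pk0]]] := edge.
pose f (b : bool) := if b then two_coords i j (- (p i)^-1) (- (p j)^-1) else
  fun=> 0.
have -> : [set l | symmetry p l] = range f.
  apply/seteqP; split=> [l gl|_ [[] _ <-]];
    [|exact: symmetry_edge|exact: symmetry0].
  have [lnz|l0] := pselect (exists i, l i != 0); last first.
    exists false => //; apply/funext => k /=.
    by apply/esym/eqP; apply: contraT => lk; case: l0; exists k.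
  have [[i' [pi' pj' _ _]]|[i' [j' [ij' pi' pij' pk' ->]]]] :=
    symmetry_cases phip gl lnz.
    by case: (on_edge_not_axis edge); exists i'.
  have nz k : (p k != 0) = (k == i) || (k == j).
    have [->|ki] := eqVneq k i; first by rewrite pi0.
    have [->|kj] := eqVneq k j; last by rewrite pk0 ?eqxx.
    apply: contraNneq pi0 => pj0; move/eqP: pij.
    by rewrite pj0 expr0n expf_eq0.
  have nz' k : (p k != 0) = (k == i') || (k == j').
    have [->|ki] := eqVneq k i'; first by rewrite pi'.
    have [->|kj] := eqVneq k j'; last by rewrite pk' ?eqxx.
    apply: contraNneq pi' => pj0; move/eqP: pij'.
    by rewrite pj0 expr0n expf_eq0.
  exists true => //; apply/funext => k; rewrite /f /two_coords.
  have ptE i1 j1 : (if k == i1 then - (p i1)^-1 else if k == j1 then - (p j1)^-1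
    else 0) =
      if (k == i1) || (k == j1) then - (p k)^-1 else 0.
    by case: eqP => [->//|_]; case: eqP => [->|].
  by rewrite !ptE -nz -nz'.
apply: card_range; last exact: card_bool.
have ft : f true i != f false i
  by rewrite /f /two_coords eqxx oppr_eq0 invr_eq0.
by case=> -[] // e; move/eqP: ft; rewrite e.
Qed.

Lemma card_symmetry_other p : quartic p != 0 -> ~ on_axis p -> ~ on_edge p ->
  [set l | symmetry p l] #= `I_1.
Proof.
move=> phip nax ned; have -> : [set l | symmetry p l] = [set fun=> 0].
  apply/seteqP; split=> [l gl|_ ->]; last exact: symmetry0.
  have [lnz|l0] := pselect (exists i, l i != 0); last first.
    apply/funext => k /=.
    by apply/eqP; apply: contraT => lk; case: l0; exists k.
  have [[i [pi0 pj0 _ _]]|[i [j [ij pi0 pij pk0 _]]]] :=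
    symmetry_cases phip gl lnz.
    by case: nax; exists i.
  by case: ned; exists i, j.
exact: card_set1.
Qed.

End SymmetryCount.

(** * Rational maps on the surface *)

Section Forms.
Local Open Scope ring_scope.
Local Open Scope classical_set_scope.
Local Open Scope card_scope.
Context (K : numClosedFieldType).
Local Notation FQ := (fermat_quartic K).
Implicit Types (v : 'rV[K]_4) (w : 'I_4 -> K) (f g h : 4.-tuple {mpoly K[4]}).

Lemma meval_fermat (w : 'I_4 -> K) : FQ.@[w] = quartic w.
Proof.
by rewrite raddf_sum; apply: eq_bigr => i _ /=; rewrite mevalXn mevalXU.
Qed.

Lemma surface_fermat v : surface FQ v <-> v != 0 /\ cone (v 0).
Proof.
rewrite /surface /= meval_fermat; split=> -[v0 cv]; split=> //.
  apply: contraNneq v0 => ->; apply/eqP/funext => i; apply/funext => j.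
  by rewrite mxE.
apply: contraNneq v0 => e; apply/eqP/rowP => j.
by have := congr1 (fun F : 'I_1 -> 'I_4 -> K => F 0 j) e; rewrite mxE.
Qed.

Lemma eval_formsE f v j : eval_forms f v 0 j = (tnth f j).@[v 0].
Proof. by rewrite mxE. Qed.

Lemma exists_surface_point : exists v, surface FQ v.
Proof.
have [x cx _] := @cone_lift K (fun=> 1) ord0.
exists (\row_i set_coord (fun=> 1) ord0 x i); apply/surface_fermat; split.
  by apply/eqP => /rowP/(_ ord_max); rewrite !mxE /set_coord /= => /eqP;
    rewrite oner_eq0.
by rewrite /cone in cx *; under eq_bigr do rewrite mxE.
Qed.

(** A polynomial that vanishes on the cone off its vertex vanishes at the vertex as
    well, being a polynomial in one variable on each line of the cone. *)
Lemma vanish_surface (g : {mpoly K[4]}) :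
  (forall v, surface FQ v -> g.@[v 0] = 0) -> vanish g.
Proof.
move=> vg w cw.
have ray u (x : K) : (u : 'rV_4) != 0 -> cone (u 0) -> x != 0 ->
  g.@[fun i => x * u 0 i] = 0.
  move=> u0 cu x0; rewrite -(vg (x *: u)).
    by apply: meval_eq => i; rewrite mxE.
  apply/surface_fermat; rewrite scaler_eq0 negb_or x0; split => //.
  by have := cone_scale x cu; rewrite /cone;
    under [in X in _ -> X]eq_bigr do rewrite mxE.
have [w0|w0] := eqVneq (\row_i w i) 0; last first.
  have := ray (\row_i w i) 1 w0; rewrite oner_neq0 => <- //.
    by apply: meval_eq => i; rewrite mxE mul1r.
  by rewrite /cone in cw *; under eq_bigr do rewrite mxE.
have [u /surface_fermat[u0 cu]] := exists_surface_point.
have : line (fun=> 0) (u 0) g = 0.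
  apply: (@poly_eq0_eval_generic K _ 'X); first by rewrite polyX_eq0.
  move=> x; rewrite hornerX => x0; rewrite horner_line;
    apply: etrans (ray u x u0 cu x0).
  by apply: meval_eq => i; exact: add0r.
move/(congr1 (horner^~ 0)); rewrite horner_line horner0 => <-.
apply: meval_eq => i; rewrite [RHS]add0r mul0r; by move/rowP/(_ i): w0;
  rewrite !mxE.
Qed.

Lemma surface_vanish (g : {mpoly K[4]}) v : vanish g -> surface FQ v ->
  g.@[v 0] = 0.
Proof. by move=> vg /surface_fermat[_ /vg]. Qed.

Lemma ratmapP f : ratmap FQ f <->
  (exists d, forall i, tnth f i \is d.-homog) /\ exists i, ~ vanish (tnth f i).
Proof.
split=> -[hom nz]; split=> //.
  case: nz => v Sv fv; case: (pselect (exists i, eval_forms f v 0 i != 0)) =>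
    [[i fi]|no].
    by exists i => vi; move/eqP: fi; rewrite eval_formsE (surface_vanish vi Sv).
  case/eqP: fv; apply/rowP => i; rewrite [RHS]mxE; apply/eqP.
  by apply: contraT => fi; case: no; exists i.
case: nz => i fi; apply: contrapT => no; apply: fi;
  apply: vanish_surface => v Sv.
apply/eqP; apply: contraT => fi; case: no; exists v => //.
by apply: contraNneq fi => f0; rewrite -eval_formsE f0 mxE.
Qed.

Definition minor2 f g i j : {mpoly K[4]} :=
  tnth f i * tnth g j - tnth f j * tnth g i.

Lemma minor2E f g i j (w : 'I_4 -> K) : (minor2 f g i j).@[w] =
  (tnth f i).@[w] * (tnth g j).@[w] - (tnth f j).@[w] * (tnth g i).@[w].
Proof. by rewrite mevalB !mevalM. Qed.

Lemma same_ratmapP f g : same_ratmap FQ f g <->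
  [/\ ratmap FQ f, ratmap FQ g & forall i j, vanish (minor2 f g i j)].
Proof.
split=> -[rf rg c]; split=> //.
  move=> i j; apply: vanish_surface => v Sv.
  by rewrite minor2E -!eval_formsE c // subrr.
move=> v Sv i j; apply/eqP; rewrite -subr_eq0 !eval_formsE -minor2E.
by rewrite (surface_vanish (c i j) Sv).
Qed.

Lemma same_ratmap_refl f : ratmap FQ f -> same_ratmap FQ f f.
Proof. by move=> rf; split=> // v _ i j; rewrite mulrC. Qed.

Lemma same_ratmap_sym f g : same_ratmap FQ f g -> same_ratmap FQ g f.
Proof.
case=> rf rg c; split=> // v Sv i j.
by rewrite [LHS]mulrC [RHS]mulrC c.
Qed.

(** Transitivity is where the irreducibility of the surface is needed: a common
    nonzero coordinate of [g] has to be cancelled. *)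
Lemma same_ratmap_trans f g h :
  same_ratmap FQ f g -> same_ratmap FQ g h -> same_ratmap FQ f h.
Proof.
move=> /same_ratmapP[rf rg fg] /same_ratmapP[_ rh gh]; apply/same_ratmapP;
  split=> // i j.
have /ratmapP[_ [k gk]] := rg.
apply: (vanishM_cancel gk) => w cw; rewrite mevalM minor2E.
have := fg k i w cw; have := fg k j w cw; have := gh i j w cw; rewrite !minor2E.
move=> /eqP + /eqP + /eqP; rewrite !subr_eq0 => /eqP gij /eqP fkj /eqP fki.
transitivity ((tnth f k).@[w] * ((tnth g i).@[w] * (tnth h j).@[w]
    - (tnth g j).@[w] * (tnth h i).@[w])); last by rewrite gij subrr mulr0.
by rewrite !mulrBr !mulrA fki fkj; ring.
Qed.

Lemma ratmap_class_eq f g : same_ratmap FQ f g -> ratmap_class FQ f =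
  ratmap_class FQ g.
Proof.
move=> fg; apply/seteqP; split=> h /=; last exact: same_ratmap_trans.
by apply: same_ratmap_trans; apply: same_ratmap_sym.
Qed.

(** A representative of a self-map takes values in the cone wherever it is defined,
    also where the representative known to map into the surface vanishes. *)
Lemma self_ratmap_quartic f g : self_ratmap FQ f -> same_ratmap FQ f g ->
  forall w, cone w -> quartic (fun i => (tnth g i).@[w]) = 0.
Proof.
move=> [rf Sf] /same_ratmapP[_ rg fg].
pose phip h := \sum_i tnth h i ^+ 4.
have phipE h w : (phip h).@[w] = quartic (fun i => (tnth h i).@[w]).
  by rewrite raddf_sum; apply: eq_bigr => i _ /=; rewrite mevalXn.
have vf : vanish (phip f).
  apply: vanish_surface => v Sv; rewrite phipE.
  have [f0|f0] := eqVneq (eval_forms f v) 0.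
    by rewrite /quartic big1 // => i _; rewrite -eval_formsE f0 mxE expr0n.
  have /surface_fermat[_] := Sf v Sv f0; rewrite /cone => c0; apply: etrans c0.
  by apply: eq_bigr => i _; rewrite eval_formsE.
have /ratmapP[_ [k fk]] := rf.
have [fk4 fk4E] : exists p, p = tnth f k ^+ 4 by exists (tnth f k ^+ 4).
suff vg : vanish (phip g) by move=> w cw; rewrite -phipE vg.
apply: (@vanishM_cancel K fk4) => [v4|w cw].
  apply: fk => w /v4; rewrite fk4E mevalXn => /eqP.
  by rewrite expf_eq0 => /eqP.
rewrite mevalM fk4E mevalXn phipE -quartic_scale.
transitivity (quartic (fun i => (tnth g k).@[w] * (tnth f i).@[w])).
  congr quartic; apply/funext => i; have := fg k i w cw;
    rewrite minor2E => /eqP.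
  by rewrite subr_eq0 => /eqP->; rewrite mulrC.
by rewrite quartic_scale -phipE vf // mulr0.
Qed.

Definition homology (p l : 'I_4 -> K) : 4.-tuple {mpoly K[4]} :=
  [tuple 'X_j + p j *: lin_poly l | j < 4].

Lemma homologyE p l (w : 'I_4 -> K) j : (tnth (homology p l) j).@[w] =
  w j + p j * lin_form l w.
Proof. by rewrite tnth_mktuple mevalD mevalXU mevalZ lin_polyE. Qed.

Lemma homology_homog p l j : tnth (homology p l) j \is 1.-homog.
Proof.
rewrite tnth_mktuple; apply: rpredD; first by rewrite dhomogX /= mdeg1.
by apply: dhomogZ; apply: lin_poly_homog.
Qed.

Lemma eval_comp g f v : eval_forms (comp_forms g f) v =
  eval_forms g (eval_forms f v).
Proof.
apply/rowP => i; rewrite !eval_formsE tnth_mktuple comp_mpoly_meval.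
by apply: meval_eq => j; rewrite eval_formsE.
Qed.

Lemma homology_neq0 p l v : quartic p != 0 -> surface FQ v ->
  eval_forms (homology p l) v != 0.
Proof.
move=> p0 /surface_fermat[v0 cv]; apply/eqP => r0.
have vE i : v 0 i = - lin_form l (v 0) * p i.
  have := congr1 (fun u : 'rV_4 => u 0 i) r0;
    rewrite eval_formsE homologyE mxE => /eqP.
  by rewrite addr_eq0 mulNr [lin_form _ _ * _]mulrC => /eqP.
have : quartic (v 0) = 0 by [].
have -> : quartic (v 0) = quartic (fun i => - lin_form l (v 0) * p i).
  by congr quartic; apply/funext => i; rewrite -vE.
rewrite quartic_scale => /eqP;
  rewrite mulf_eq0 (negPf p0) orbF expf_eq0 oppr_eq0 /=.
move=> /eqP l0; case/eqP: v0; apply/rowP => i.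
by rewrite vE l0 oppr0 mul0r mxE.
Qed.

Lemma ratmap_homology p l : quartic p != 0 -> ratmap FQ (homology p l).
Proof.
move=> p0; split; first by exists 1%N => i; apply: homology_homog.
by have [v Sv] := exists_surface_point; exists v => //; apply: homology_neq0.
Qed.

Lemma self_ratmap_homology p l : quartic p != 0 -> symmetry p l ->
  self_ratmap FQ (homology p l).
Proof.
move=> p0 gl; split; first exact: ratmap_homology.
move=> v /surface_fermat[v0 cv] r0; apply/surface_fermat; split => //.
apply: etrans (etrans (gl (v 0)) cv); apply: eq_bigr => i _; congr (_ ^+ _).
by rewrite eval_formsE homologyE.
Qed.

(** The inverse is again a homology with the same centre.  As [p] itself is mapped
    to [(1 + l(p)) p] and F(p) is not 0, the factor [1 + l(p)] is not 0. *)
Lemma symmetry_inv p l : quartic p != 0 -> symmetry p l ->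
  exists2 l', symmetry p l' &
  (forall v, eval_forms (homology p l') (eval_forms (homology p l) v) = v) /\
  (forall v, eval_forms (homology p l) (eval_forms (homology p l') v) = v).
Proof.
move=> p0 gl; pose c := 1 + lin_form l p.
have c0 : c != 0.
  apply/eqP => c0; have := gl p; have -> : (fun i => p i + p i * lin_form l p) =
    (fun i => c * p i).
    by apply/funext => i; rewrite mulrC /c mulrDl mul1r.
  by rewrite quartic_scale c0 expr0n mul0r => /esym/eqP; rewrite (negPf p0).
pose l' i := - l i / c.
have l'E u : lin_form l' u = - lin_form l u / c.
  by rewrite /lin_form -sumrN mulr_suml; apply: eq_bigr => i _; rewrite /l';
    ring.
have linp_p l1 u x : lin_form l1 (fun i => u i + p i * x) =
  lin_form l1 u + x * lin_form l1 p.
  by rewrite lin_formD -lin_form_scale; congr (_ + lin_form _ _);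
    apply/funext => i; rewrite mulrC.
have inv1 u i : (u i + p i * lin_form l u) + p i * lin_form l' (fun i =>
  u i + p i * lin_form l u) = u i.
  by rewrite l'E linp_p /c; field.
have inv2 u i : (u i + p i * lin_form l' u) + p i * lin_form l (fun i =>
  u i + p i * lin_form l' u) = u i.
  by rewrite linp_p l'E /c; field.
exists l'.
  move=> u; rewrite -[LHS](gl (fun i => u i + p i * lin_form l' u));
    congr quartic.
  by apply/funext => i; rewrite inv2.
by split=> v; apply/rowP => i;
  rewrite eval_formsE homologyE eval_formsE homologyE;
  [rewrite -[RHS](inv1 (v 0))|rewrite -[RHS](inv2 (v 0))];
    congr (_ + _ * lin_form _ _);
  apply/funext => j; rewrite eval_formsE homologyE.
Qed.

Lemma id_formsE v : eval_forms (id_forms K) v = v.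
Proof. by apply/rowP => i; rewrite eval_formsE tnth_mktuple mevalXU. Qed.

Lemma id_forms_homog i : tnth (id_forms K) i \is 1.-homog.
Proof. by rewrite tnth_mktuple dhomogX /= mdeg1. Qed.

Lemma comp_homog g f d : (forall i, tnth g i \is 1.-homog) ->
  (forall i, tnth f i \is d.-homog) ->
    forall i, tnth (comp_forms g f) i \is d.-homog.
Proof.
by move=> hg hf i; rewrite tnth_mktuple -[d]muln1; apply: dhomog_comp.
Qed.

Lemma same_ratmap_eval f g (d e : nat) : (forall i, tnth f i \is d.-homog) ->
  (forall i, tnth g i \is e.-homog) ->
  (forall v, eval_forms f v = eval_forms g v) ->
  (exists2 v, surface FQ v & eval_forms g v != 0) -> same_ratmap FQ f g.
Proof.
move=> hf hg fg [v Sv gv]; split.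
- by split; [exists d|exists v => //; rewrite fg].
- by split; [exists e|exists v].
- by move=> u _ i j; rewrite fg mulrC.
Qed.

Lemma birational_homology p l : quartic p != 0 -> symmetry p l ->
  birational FQ (homology p l).
Proof.
move=> p0 gl; split; first exact: self_ratmap_homology.
have [l' gl' [e1 e2]] := symmetry_inv p0 gl.
have [v Sv] := exists_surface_point; have [v0 _] := (surface_fermat v).1 Sv.
have idP : exists2 v, surface FQ v & eval_forms (id_forms K) v != 0.
  by exists v => //; rewrite id_formsE.
exists (homology p l'); split; first exact: self_ratmap_homology.
- apply: (same_ratmap_eval (d := 1) (e := 1)) => //; try exact: id_forms_homog.
    by apply: comp_homog; apply: homology_homog.
  by move=> u; rewrite eval_comp id_formsE.
- apply: (same_ratmap_eval (d := 1) (e := 1)) => //; try exact: id_forms_homog.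
    by apply: comp_homog; apply: homology_homog.
  by move=> u; rewrite eval_comp id_formsE.
Qed.

(** Two homologies with centre [p] and equal classes move every point of the surface
    by the same multiple of [p], so their linear forms agree on the cone. *)
Lemma homology_class_inj p l1 l2 : quartic p != 0 ->
  ratmap_class FQ (homology p l1) = ratmap_class FQ (homology p l2) -> l1 = l2.
Proof.
move=> p0 e.
have : ratmap_class FQ (homology p l1) (homology p l2).
  by rewrite e; apply: same_ratmap_refl; apply: ratmap_homology.
move=> /same_ratmapP[_ _ c].
pose dl i := l1 i - l2 i.
have dlE w : lin_form dl w = lin_form l1 w - lin_form l2 w.
  by rewrite /lin_form -sumrB; apply: eq_bigr => i _; rewrite mulrBl.
suff : vanish (lin_poly dl).
  move/(vanish_small_degree (d := 1) isT (lin_poly_homog dl)).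
  move/lin_poly_eq0 => d0.
  apply/funext => i; apply/eqP; rewrite -subr_eq0; apply/eqP.
  exact: (congr1 (fun F : 'I_4 -> K => F i) d0).
have [i pi0] : exists i, p i != 0.
  apply: contrapT => no; case/eqP: p0; rewrite /quartic big1 // => i _.
  have -> : p i = 0 by apply/eqP; apply: contraT => pi0; case: no; exists i.
  by rewrite expr0n.
have [j ij] := other_index i.
pose x : {mpoly K[4]} := p i *: 'X_j - p j *: 'X_i.
have xE w : x.@[w] = p i * w j - p j * w i by rewrite mevalB !mevalZ !mevalXU.
apply: (@vanishM_cancel K x).
  have hx : x \is 1.-homog.
    by apply: rpredB; apply: dhomogZ; rewrite dhomogX /= mdeg1.
  move=> /(vanish_small_degree (d := 1) isT hx) x0.
  have := xE (fun k => (k == j)%:R);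
    rewrite x0 meval0 eqxx (negPf ij) mulr0 subr0 mulr1.
  by move/esym/eqP; rewrite (negPf pi0).
move=> w cw; rewrite mevalM xE lin_polyE dlE -(c i j w cw) minor2E !homologyE;
  ring.
Qed.

End Forms.

(** * The group of the projection from a point *)

Section GaloisGroup.
Local Open Scope ring_scope.
Local Open Scope classical_set_scope.
Local Open Scope card_scope.
Context (K : numClosedFieldType).
Local Notation FQ := (fermat_quartic K).
Implicit Types (v p : 'rV[K]_4) (w l : 'I_4 ->
  K) (f g h : 4.-tuple {mpoly K[4]}).

Lemma proj_formsE (P : {vspace 'rV[K]_4}) v :
  eval_forms (proj_forms P) v = daddv_pi (P^C) P v.
Proof.
apply/rowP => j; rewrite eval_formsE tnth_mktuple raddf_sum /=.
rewrite [in RHS](row_sum_delta v) linear_sum summxE; apply: eq_bigr => i _ /=.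
by rewrite [in RHS]linearZ mxE mevalZ mevalXU mulrC.
Qed.

Lemma proj_homog (P : {vspace 'rV[K]_4}) j : tnth (proj_forms P) j \is 1.-homog.
Proof.
rewrite tnth_mktuple; apply: rpred_sum => i _; apply: dhomogZ.
by rewrite dhomogX /= mdeg1.
Qed.

Lemma proj_eq0 (P : {vspace 'rV[K]_4}) v : (daddv_pi (P^C) P v == 0) =
  (v \in P).
Proof.
have cap : (P^C :&: P)%VS = 0%VS by rewrite capvC capv_compl.
have vE : daddv_pi (P^C) P v + daddv_pi P (P^C) v = v.
  by apply: daddv_pi_add => //; rewrite addvC addv_complf memvf.
apply/eqP/idP => [e|vP]; first by rewrite -vE e add0r memv_pi.
by move: vE; rewrite (daddv_pi_id (capv_compl P) vP) => /(canRL (addrK _));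
  rewrite subrr.
Qed.

Lemma surface_notin p v : quartic (p 0) != 0 -> surface FQ v ->
  v \notin <[p]>%VS.
Proof.
move=> p0 /surface_fermat[v0 cv]; apply/negP => /vlineP[k vE].
have : quartic (v 0) = 0 by [].
rewrite (_ : v 0 = fun i => k * p 0 i); last by apply/funext => i;
  rewrite vE mxE.
rewrite quartic_scale => /eqP;
  rewrite mulf_eq0 (negPf p0) orbF expf_eq0 => /eqP k0.
by rewrite vE k0 scale0r eqxx in v0.
Qed.

Lemma ratmap_proj p : quartic (p 0) != 0 -> ratmap FQ (proj_forms <[p]>).
Proof.
move=> p0; split; first by exists 1%N; apply: proj_homog.
have [v Sv] := exists_surface_point K; exists v => //.
by rewrite proj_formsE proj_eq0 surface_notin.
Qed.

Lemma homology_in_G p l : quartic (p 0) != 0 -> symmetry (p 0) l ->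
  G FQ <[p]> (ratmap_class FQ (homology (p 0) l)).
Proof.
move=> p0 gl; split; first by exists (homology (p 0) l) => //;
  apply: birational_homology.
exists (homology (p 0) l); first by apply: same_ratmap_refl;
  apply: ratmap_homology.
apply: (same_ratmap_eval (d := 1) (e := 1)).
- apply: comp_homog; [exact: proj_homog|exact: homology_homog].
- exact: proj_homog.
- move=> v; rewrite eval_comp !proj_formsE.
  have -> : eval_forms (homology (p 0) l) v = v + lin_form l (v 0) *: p.
    by apply/rowP => i; rewrite eval_formsE homologyE !mxE [p 0 i * _]mulrC.
  rewrite linearD; apply/eqP; rewrite -subr_eq0 addrC addKr proj_eq0.
  by rewrite rpredZ // memv_line.
- by have [_] := ratmap_proj p0.
Qed.

(** Having the same projection from [P] as [v] means lying in the span of [v] and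
    [p]. *)
Lemma proj_compatible p f v : quartic (p 0) != 0 ->
  same_ratmap FQ (comp_forms (proj_forms <[p]>) f) (proj_forms <[p]>) ->
  surface FQ v -> exists a b, eval_forms f v = a *: v + b *: p.
Proof.
move=> p0 [_ _ c] Sv; have cv := c v Sv.
pose P := <[p]>%VS; pose pr := daddv_pi (P^C) P.
have : pr v != 0 by rewrite proj_eq0 surface_notin.
have [[j prj]|no] := pselect (exists j, pr v 0 j != 0); last first.
  case/eqP; apply/rowP => j; rewrite mxE; apply/eqP.
  by apply: contraT => prj; case: no; exists j.
move=> _; pose a := pr (eval_forms f v) 0 j / pr v 0 j.
have : pr (eval_forms f v - a *: v) == 0.
  rewrite linearB linearZ subr_eq0; apply/eqP/rowP => i; rewrite mxE.
  apply: (mulIf prj); have := cv i j; rewrite eval_comp !proj_formsE => ->.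
  by rewrite mulrAC /a divfK.
rewrite proj_eq0 => /vlineP[b e]; exists a, b.
by rewrite -e addrC subrK.
Qed.

(** In coordinates, if [f(v) = a v + b p], then [D = a x] and [N = b x] for the
    linear form [x = p_i v_j - p_j v_i], so that [x f(v) = D v + N p].  Applying F
    gives the equation of [homology_of_equation]. *)
Lemma G_is_homology p t : quartic (p 0) != 0 -> G FQ <[p]> t ->
  exists2 l, symmetry (p 0) l & ratmap_class FQ (homology (p 0) l) = t.
Proof.
move=> p0 [[f0 [Sf0 _] <-] [f f0f compat]]; rewrite /= in f0f.
have [i pi0] : exists i, p 0 i != 0.
  apply: contrapT => no; case/eqP: p0; rewrite /quartic big1 // => i _.
  have -> : p 0 i = 0 by apply/eqP; apply: contraT => pi0; case: no; exists i.
  by rewrite expr0n.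
have phif := self_ratmap_quartic Sf0 f0f.
have [_ rf _] := f0f; have [[d hf] [v1 Sv1 fv1]] := rf.
pose D j := p 0 i *: tnth f j - p 0 j *: tnth f i.
pose N j := tnth f i * 'X_j - tnth f j * 'X_i.
pose x j : {mpoly K[4]} := p 0 i *: 'X_j - p 0 j *: 'X_i.
have xE j w : (x j).@[w] = p 0 i * w j - p 0 j * w i.
  by rewrite mevalB !mevalZ !mevalXU.
have DE j w : (D j).@[w] = p 0 i * (tnth f j).@[w] - p 0 j * (tnth f i).@[w].
  by rewrite mevalB !mevalZ.
have NE j w : (N j).@[w] = (tnth f i).@[w] * w j - (tnth f j).@[w] * w i.
  by rewrite mevalB !mevalM !mevalXU.
have hX k : ('X_k : {mpoly K[4]}) \is 1.-homog by rewrite dhomogX /= mdeg1.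
have hD j : D j \is d.-homog by apply: rpredB; apply: dhomogZ.
have hN j : N j \is (d.+1).-homog by rewrite -(addn1 d); apply: rpredB;
  apply: dhomogM.
clearbody D N x.
have [j Dj] : exists j, (D j).@[v1 0] != 0.
  apply: contrapT => no; have [_ cv1] := (surface_fermat v1).1 Sv1.
  pose c := (tnth f i).@[v1 0] / p 0 i.
  have fE k : (tnth f k).@[v1 0] = c * p 0 k.
    have : (D k).@[v1 0] = 0.
      by apply/eqP; apply: contraT => Dk; case: no; exists k.
    rewrite DE => /eqP; rewrite subr_eq0 => /eqP e.
    by apply: (mulfI pi0); rewrite e /c; field.
  have := phif _ cv1; rewrite (_ : (fun i => _) = fun k => c * p 0 k);
    last first.
    by apply/funext => k; rewrite fE.
  rewrite quartic_scale => /eqP;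
    rewrite mulf_eq0 (negPf p0) orbF expf_eq0 /= => /eqP c0.
  case/eqP: fv1; apply/rowP => k.
  by rewrite eval_formsE fE c0 mul0r mxE.
have vD : ~ vanish (D j) by move=> /surface_vanish/(_ Sv1)/eqP;
  rewrite (negPf Dj).
have key k : vanish (x j * tnth f k - (D j * 'X_k + p 0 k *: N j)).
  apply: vanish_surface => v Sv.
  have [a [b fE]] := proj_compatible p0 compat Sv.
  have {}fE m : (tnth f m).@[v 0] = a * v 0 m + b * p 0 m.
    by rewrite -eval_formsE fE !mxE.
  rewrite mevalB mevalM mevalD mevalM mevalZ mevalXU xE DE NE !fE; ring.
have keyE w k : cone w ->
    (x j).@[w] * (tnth f k).@[w] = (D j).@[w] * w k + p 0 k * (N j).@[w].
  move=> cw; have := key k w cw;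
    rewrite mevalB mevalM mevalD mevalM mevalZ mevalXU.
  by move/eqP; rewrite subr_eq0 => /eqP.
have eqn w : cone w -> quartic (fun k =>
  (D j).@[w] * w k + p 0 k * (N j).@[w]) = 0.
  move=> cw; rewrite -[RHS](mulr0 ((x j).@[w] ^+ 4)) -(phif w cw)
    -quartic_scale.
  by congr quartic; apply/funext => k; rewrite -keyE.
have [l gl lE] := homology_of_equation (hN j) (hD j) vD p0 eqn.
exists l => //; apply: ratmap_class_eq; apply: same_ratmap_sym.
apply: (same_ratmap_trans f0f); apply/same_ratmapP; split => //;
  first exact: ratmap_homology.
have xv : ~ vanish (x j).
  move=> vx; apply: vD; apply: vanish_surface => v Sv.
  have [a [b fE]] := proj_compatible p0 compat Sv.
  have {}fE m : (tnth f m).@[v 0] = a * v 0 m + b * p 0 m.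
    by rewrite -eval_formsE fE !mxE.
  rewrite -[RHS](mulr0 a) -(surface_vanish vx Sv) DE xE !fE; ring.
move=> k m; apply: (vanishM_cancel xv) => w cw;
  rewrite mevalM minor2E !homologyE.
rewrite mulrBr !mulrA !keyE // lE //; ring.
Qed.

Lemma card_G p : quartic (p 0) != 0 -> G FQ <[p]> #= [set l | symmetry (p 0) l].
Proof.
move=> p0; have -> : G FQ <[p]> =
    [set ratmap_class FQ (homology (p 0) l) | l in [set l | symmetry (p 0) l]].
  apply/seteqP; split=> [t /(G_is_homology p0)[l gl <-]|_ [l gl <-]]; first
    by exists l.
  exact: homology_in_G.
by apply: inj_card_eq => l1 l2 _ _; apply: homology_class_inj.
Qed.

Lemma lies_on_line p : p != 0 -> ~ lies_on <[p]> FQ <-> quartic (p 0) != 0.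
Proof.
move=> pn0; split=> [nl|p0 lo].
  apply/eqP => p0; apply: nl => v /vlineP[k vE] v0; apply/surface_fermat.
  split=> //; rewrite /cone -/(quartic _) (_ : v 0 = fun i => k * p 0 i).
    by rewrite quartic_scale p0 mulr0.
  by apply/funext => i; rewrite vE mxE.
have /surface_fermat[_] := lo p (memv_line p) pn0.
by move/eqP: p0.
Qed.

End GaloisGroup.

(** * Counting the points *)

Section Count.
Local Open Scope ring_scope.
Local Open Scope classical_set_scope.
Local Open Scope card_scope.
Context (K : numClosedFieldType).
Local Notation FQ := (fermat_quartic K).
Implicit Types (p q : 'rV[K]_4) (w : 'I_4 -> K) (P : {vspace 'rV[K]_4}).

Lemma P3_line P : P3 P -> exists2 p, p != 0 & P = <[p]>%VS.
Proof.
rewrite /P3 /= => dP; exists (vpick P).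
  by rewrite vpick0 -dimv_eq0 dP.
apply/eqP; rewrite eq_sym eqEdim dP dim_vline -memvE memv_pick /=.
by rewrite vpick0 -dimv_eq0 dP.
Qed.

Lemma line_P3 p : p != 0 -> P3 <[p]>%VS.
Proof. by rewrite /P3 /= dim_vline => ->. Qed.

Lemma quartic_neq0 p : quartic (p 0) != 0 -> p != 0.
Proof.
apply: contraNneq => ->; rewrite /quartic big1 // => i _.
by rewrite mxE expr0n.
Qed.

Lemma card_G_eq4 (P : {vspace 'rV[K]_4}) (n : nat) :
  G FQ P #= `I_n -> G FQ P #= `I_4 -> n = 4%N.
Proof. by move=> e; rewrite (card_eql e) => /card_eq_II. Qed.

Lemma quasi_card (P : {vspace 'rV[K]_4}) (n : nat) :
  G FQ P #= `I_n -> (`I_2 #<= G FQ P) = (1 < n)%N.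
Proof. by move=> e; rewrite (card_le_eqr e) card_le_II. Qed.

Lemma card_G_trichotomy p : quartic (p 0) != 0 ->
  [\/ on_axis (p 0) /\ G FQ <[p]> #= `I_4,
      on_edge (p 0) /\ G FQ <[p]> #= `I_2 |
      [/\ ~ on_axis (p 0), ~ on_edge (p 0) & G FQ <[p]> #= `I_1]].
Proof.
move=> p0; have e := card_G p0.
have [ax|nax] := pselect (on_axis (p 0)).
  by apply: Or31; split=> //; apply: card_eq_trans e (card_symmetry_axis ax).
have [ed|ned] := pselect (on_edge (p 0)).
  by apply: Or32; split=> //; apply: card_eq_trans e (card_symmetry_edge ed).
by apply: Or33; split=> //;
  apply: card_eq_trans e (card_symmetry_other p0 nax ned).
Qed.

Lemma galoisP : galois FQ =
  [set <[p]>%VS | p in [set p : 'rV[K]_4 | on_axis (p 0)]].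
Proof.
apply/seteqP; split=> [P [/P3_line[p pn0 ->]]|_ [p ax <-]].
  move=> /(lies_on_line pn0) p0 g4; exists p => //=.
  have [[]//|[_ g2]|[_ _ g1]] := card_G_trichotomy p0.
    by have := card_G_eq4 g2 g4.
  by have := card_G_eq4 g1 g4.
have p0 := on_axis_quartic ax; have pn0 := quartic_neq0 p0.
split; [exact: line_P3|exact/lies_on_line|].
exact: card_eq_trans (card_G p0) (card_symmetry_axis ax).
Qed.

Lemma quasi_not_galoisP : quasi_galois FQ `\` galois FQ =
  [set <[p]>%VS | p in [set p : 'rV[K]_4 | on_edge (p 0)]].
Proof.
apply/seteqP; split=> [P [[/P3_line[p pn0 ->]]]|_ [p ed <-]].
  move=> /(lies_on_line pn0) p0 g2 ng; exists p => //=.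
  have [[ax _]|[]//|[_ _ g1]] := card_G_trichotomy p0.
    by case: ng; rewrite galoisP; exists p.
  by move: g2; rewrite (quasi_card g1).
have p0 := on_edge_quartic ed; have pn0 := quartic_neq0 p0.
have g2 := card_eq_trans (card_G p0) (card_symmetry_edge ed).
split; first split; [exact: line_P3|exact/lies_on_line| |].
  by rewrite (quasi_card g2).
by case=> _ _ g4; have := card_G_eq4 g2 g4.
Qed.

Lemma galois_quasi : galois FQ `<=` quasi_galois FQ.
Proof. by move=> P [P3P nl g4]; split=> //; rewrite (quasi_card g4). Qed.

Definition vertex (i : 'I_4) : {vspace 'rV[K]_4} := <[\row_k (k == i)%:R]>%VS.

Definition edge_index := {x : 'I_4 * 'I_4 * 'I_4 | (x.1.1 < x.1.2)%N}.

(** On an edge, [p] can be scaled to have first coordinate 1; the second one is then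
    a fourth root of unity. *)
Definition edge_point (x : edge_index) : {vspace 'rV[K]_4} :=
  let: (i, j, k) := val x in <[\row_l two_coords i j 1 ('i ^+ k) l]>%VS.

(** Six pairs of coordinates, with four fourth roots of unity for each. *)
Lemma card_edge_index : #|{: edge_index}| = 24%N.
Proof.
rewrite card_sig -sum1_card big_mkcond /=.
transitivity (\sum_(i < 4) \sum_(j < 4) \sum_(k < 4) if (i < j)%N then 1 else
  0)%N.
  by rewrite pair_big pair_big; apply: eq_bigr => -[[i j] k] _; rewrite inE.
by rewrite !big_ord_recl !big_ord0.
Qed.

Lemma row_fun w : (\row_k w k : 'rV[K]_4) 0 = w.
Proof. by apply/funext => k; rewrite mxE. Qed.

Lemma line_scale p (c : K) : c != 0 -> <[c *: p]>%VS = <[p]>%VS.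
Proof.
move=> c0; apply/vspaceP => v; apply/vlineP/vlineP => -[a ->].
  by exists (a * c); rewrite scalerA.
by exists (a / c); rewrite scalerA divfK.
Qed.

(** Points of projective space are compared through the homogeneous coordinates of
    their generators, which are determined up to a scalar. *)
Lemma line_inj w1 w2 : <[\row_k w1 k : 'rV[K]_4]>%VS =
  <[\row_k w2 k : 'rV[K]_4]>%VS ->
  exists c, forall k, w1 k = c * w2 k.
Proof.
move=> e; have := memv_line (\row_k w1 k : 'rV[K]_4);
  rewrite e => /vlineP[c /rowP cE].
by exists c => k; have := cE k; rewrite !mxE.
Qed.

Lemma galois_range : galois FQ = range vertex.
Proof.
rewrite galoisP; apply/seteqP; split=> [_ [p [i pi0 pj0] <-]|_ [i _ <-]].
  exists i => //; rewrite /vertex -(line_scale _ pi0); congr (<[_]>%VS).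
  apply/rowP => k; rewrite !mxE; have [->|ki] := eqVneq k i; first
    by rewrite mulr1.
  by rewrite mulr0 pj0.
exists (\row_k (k == i)%:R) => //=; rewrite row_fun;
  exists i => [|j /negPf->//].
by rewrite eqxx oner_neq0.
Qed.

Lemma i_exp_neq0 k : 'i ^+ k != 0 :> K.
Proof. by rewrite expf_neq0 // neq0Ci. Qed.

Lemma edge_range : quasi_galois FQ `\` galois FQ = range edge_point.
Proof.
rewrite quasi_not_galoisP; apply/seteqP;
  split=> [_ [p /= ed <-]|_ [[[[i j] k] /= ij] _ <-]].
  have [i [j [ij pi0 pij pk0]]] : exists i j : 'I_4, [/\ (i < j)%N, p 0 i != 0,
      p 0 i ^+ 4 = p 0 j ^+ 4 & forall k, k != i -> k != j -> p 0 k = 0].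
    have [i [j [ij pi0 pij pk0]]] := ed.
    have [lt|ge] := ltnP i j; first by exists i, j.
    have pj0 : p 0 j != 0.
      apply: contraNneq pi0 => pj0; move/eqP: pij.
      by rewrite pj0 expr0n expf_eq0.
    exists j, i; split => //; last by move=> k kj ki; apply: pk0.
    by rewrite ltn_neqAle ge eq_sym val_eqE ij.
  have [m mE] : exists m : 'I_4, p 0 j / p 0 i = 'i ^+ m.
    by apply: fourth_root_of_unity; rewrite expr_div_n -pij divff // expf_neq0.
  exists (exist _ (i, j, m) ij) => //;
    rewrite /edge_point /= -(line_scale _ pi0).
  congr (<[_]>%VS); apply/rowP => k; rewrite !mxE /two_coords.
  have [->|ki] := eqVneq k i; first by rewrite mulr1.
  have [->|kj] := eqVneq k j; first by rewrite -mE mulrC divfK.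
  by rewrite mulr0 pk0.
exists (\row_l two_coords i j 1 ('i ^+ k) l) => //=; rewrite row_fun.
have ji : j != i by rewrite -val_eqE gtn_eqF.
exists i, j; rewrite /two_coords !eqxx (negPf ji) eq_sym ji; split => //.
- exact: oner_neq0.
- by rewrite expr1n i_exp4.
- by move=> l /negPf-> /negPf->.
Qed.

Definition special_point (x : 'I_4 + edge_index) : {vspace 'rV[K]_4} :=
  match x with inl i => vertex i | inr e => edge_point e end.

Lemma vertex_inj : injective vertex.
Proof.
move=> i j /line_inj[c /(_ i)]; rewrite eqxx; case: eqP => // _ /eqP.
by rewrite mulr0 oner_eq0.
Qed.

Lemma edge_point_inj : injective edge_point.
Proof.
move=> [[[i j] m] /= ij] [[[i' j'] m'] /= ij'] /line_inj[c cE].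
have nz (k l n : 'I_4) : two_coords k l 1 ('i ^+ n) k != 0 :> K /\
  two_coords k l 1 ('i ^+ n) l != 0 :> K.
  by rewrite /two_coords !eqxx; split; rewrite ?oner_neq0 //; case: ifP;
    rewrite ?oner_neq0 ?i_exp_neq0.
have supp k : two_coords i j 1 ('i ^+ m) k != 0 :> K -> (k == i') || (k == j').
  by rewrite cE mulf_eq0 negb_or /two_coords => /andP[_]; case: ifP => // _;
    case: ifP; rewrite ?eqxx.
have := supp i (nz i j m).1; have := supp j (nz i j m).2.
move=> /orP[]/eqP jE /orP[]/eqP iE; subst.
- by have := ij; rewrite ltnn.
- by move: (ltn_trans ij ij'); rewrite ltnn.
- have ji : j' != i' by rewrite -val_eqE gtn_eqF.
  have := cE i'; rewrite /two_coords eqxx mulr1 => c1; have := cE j'.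
  rewrite /two_coords (negPf ji) eqxx -c1 mul1r => /i_pow_inj mm;
    apply: val_inj => /=.
  by rewrite mm.
- by have := ij; rewrite ltnn.
Qed.

Lemma vertex_neq_edge i e : vertex i <> edge_point e.
Proof.
case: e => [[[k l] m] /= kl] /esym/line_inj[c cE].
have lk : l != k by rewrite -val_eqE gtn_eqF.
have /eqP ki : k == i.
  have := cE k; rewrite /two_coords eqxx; case: eqP => // _ /eqP.
  by rewrite mulr0 oner_eq0.
have /eqP li : l == i.
  have := cE l; rewrite /two_coords eqxx (negPf lk); case: eqP => // _ /eqP.
  by rewrite mulr0 (negPf (i_exp_neq0 _)).
by rewrite ki li ltnn in kl.
Qed.

Lemma special_point_inj : injective special_point.
Proof.
move=> [i|e] [i'|e'] /=; first by move/vertex_inj->.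
- by move/vertex_neq_edge.
- by move/esym/vertex_neq_edge.
- by move/edge_point_inj->.
Qed.

Lemma special_point_range : quasi_galois FQ = range special_point.
Proof.
apply/seteqP; split=> [P qP|_ [[i|e] _ <-]] /=.
- have [gP|ngP] := pselect (galois FQ P).
    by move: gP; rewrite galois_range => -[i _ <-]; exists (inl i).
  have : (quasi_galois FQ `\` galois FQ) P by [].
  by rewrite edge_range => -[e _ <-]; exists (inr e).
- by apply: galois_quasi; rewrite galois_range; exists i.
- have : (quasi_galois FQ `\` galois FQ) (edge_point e) by rewrite edge_range;
  exists e.
  by case.
Qed.

Theorem count_fermat : [/\ galois FQ #= `I_4,
      quasi_galois FQ `\` galois FQ #= `I_24 &
      quasi_galois FQ #= `I_28].
Proof.
split.
- by rewrite galois_range; apply: card_range vertex_inj _; rewrite card_ord.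
- by rewrite edge_range; apply: card_range edge_point_inj card_edge_index.
- rewrite special_point_range; apply: card_range special_point_inj _.
  by rewrite card_sum card_ord card_edge_index.
Qed.

End Count.

Local Open Scope classical_set_scope.
Local Open Scope card_scope.
Local Open Scope complex_scope.

Theorem theorem5p4 (R : realType) :
  let S := fermat_quartic R[i] in
  [/\ galois S #= `I_4,
      quasi_galois S `\` galois S #= `I_24 &
      quasi_galois S #= `I_28].
Proof. exact: count_fermat. Qed.
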